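(* Fix positive constants $\alpha,\beta,\gamma$, and let $m=\beta n^{\alpha}$ and $p=\gamma n^{-(1+\alpha)/2}$. Let $G=G(n,m,p)$. Then, with high probability (as $n\to\infty$): (i) if $\alpha<1$, the model $G(n,m,p)$ is somewhere dense and $G$ has degeneracy $\Omega(\gamma n^{(1-\alpha)/2})$; (ii) if $\alpha=1$, the model $G(n,m,p)$ is somewhere dense and $G$ has degeneracy $\Omega\!\left(\frac{\log n}{\log\log n}\right)$; (iii) if $\alpha>1$, the model $G(n,m,p)$ has bounded expansion, and consequently $G$ has degeneracy $O(1)$.
   Context: Random intersection graph $G(n,m,p)$: take a random bipartite graph $B=(V,A,E)$ with $|V|=n$ vertices (''nodes''), $|A|=m$ ''attributes'', where each of the $nm$ possible edges between $V$ and $A$ is present independently with probability $p$. The graph $G(n,m,p)$ has vertex set $V$, and two distinct vertices are adjacent iff they have a common neighbour (attribute) in $B$. ''With high probability'' (w.h.p.) means with probability tending to $1$ as $n\to\infty$. For a graph $H$, a subdivision of $H$ is obtained by replacing edges of $H$ by internally vertex-disjoint paths; the vertices corresponding to $V(H)$ are called nails. For a half-integer $r\ge 0$, $H$ is an $r$-shallow topological minor of $G$ if $G$ contains as a subgraph a subdivision of $H$ in which every edge of $H$ is replaced by a path of length at most $2r+1$. The density of a graph is $|E|/|V|$. The topological grad $\tilde\nabla_r(G)$ is the maximum density of an $r$-shallow topological minor of $G$. The random graph model has bounded expansion (w.h.p.) if there is a function $f$ such that for every $r\ge0$, $\Pr[\tilde\nabla_r(G(n,m,p))\le f(r)]\to1$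 as $n\to\infty$. The model is somewhere dense if there exists $r\ge 0$ such that for every $t$, w.h.p. the complete graph $K_t$ is an $r$-shallow topological minor of $G(n,m,p)$. Degeneracy is the usual graph degeneracy. *)

(* Defs.v *)
From Stdlib Require Import Reals ClassicalEpsilon.
From HB Require Import structures.
From mathcomp Require Import all_boot.

Set Implicit Arguments.
Unset Strict Implicit.
Unset Printing Implicit Defensive.

Definition mindeg (T : finType) (e : rel T) (S : {set T}) : nat :=
  \big[minn/#|T|]_(v in S) #|[set u in S | e v u]|.

Definition degeneracy (T : finType) (e : rel T) : nat :=
  \max_(S : {set T} | S != set0) mindeg e S.

(* A simple graph H on vertex set 'I_h is encoded by eH : rel 'I_h; its edges
   are the pairs {i,j} with i < j and eH i j. *)
Definition nedges (h : nat) (eH : rel 'I_h) : nat :=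
  #|[set ij : 'I_h * 'I_h | (ij.1 < ij.2)%N && eH ij.1 ij.2]|.

(* H is an r-shallow topological minor of G, where k = 2r (r half-integer >= 0):
   G contains a subdivision of H, with nails [nail i], in which the edge {i,j}
   (i<j) is replaced by the path nail i -- P i j -- nail j of length
   size (P i j) + 1 <= 2r+1; internal vertices are distinct, are not nails,
   and paths of different edges are internally vertex-disjoint. *)
Definition shallow_top_minor (h : nat) (eH : rel 'I_h) (T : finType) (e : rel T)
    (k : nat) : Prop :=
  exists (nail : 'I_h -> T) (P : 'I_h -> 'I_h -> seq T),
    injective nail /\
    (forall i j : 'I_h, (i < j)%N -> eH i j ->
       [/\ path e (nail i) (rcons (P i j) (nail j)),
           (size (P i j) <= k)%N,
           uniq (P i j) &
           forall x, x \in P i j -> forall l : 'I_h, x != nail l]) /\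
    (forall i j i' j' : 'I_h, (i < j)%N -> eH i j -> (i' < j')%N -> eH i' j' ->
       (i, j) <> (i', j') -> forall x, x \in P i j -> x \notin P i' j').

Definition complete_rel (t : nat) : rel 'I_t := fun i j => i != j.

(* Topological grad with k = 2r is at most c: every r-shallow topological
   minor H (with at least one vertex) has density |E(H)|/|V(H)| <= c. *)
Definition top_grad_le (T : finType) (e : rel T) (k : nat) (c : R) : Prop :=
  forall (h : nat) (eH : rel 'I_h), (0 < h)%N -> shallow_top_minor eH e k ->
    Rle (Rdiv (INR (nedges eH)) (INR h)) c.

(* A bipartite graph between nodes 'I_n and attributes 'I_m. *)
Definition bip (n m : nat) := {ffun 'I_n * 'I_m -> bool}.

(* Probability of B when each of the nm edges is present independently w.p. p. *)
Definition bip_weight (n m : nat) (p : R) (B : bip n m) : R :=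
  Rmult (pow p #|[set x | B x]|) (pow (Rminus 1 p) (n * m - #|[set x | B x]|)%N).

Definition rig_adj (n m : nat) (B : bip n m) : rel 'I_n :=
  fun u v => (u != v) && [exists a : 'I_m, B (u, a) && B (v, a)].

Definition prob_G (n m : nat) (p : R) (E : rel 'I_n -> Prop) : R :=
  \big[Rplus/R0]_(B : bip n m)
     (if excluded_middle_informative (E (rig_adj B)) then bip_weight p B else R0).

Definition m_of (alpha beta : R) (n : nat) : nat :=
  Z.to_nat (Int_part (Rmult beta (Rpower (INR n) alpha))).
Definition p_of (alpha gamma : R) (n : nat) : R :=
  Rmult gamma (Rpower (INR n) (Ropp (Rdiv (Rplus 1 alpha) 2))).

Definition whp (alpha beta gamma : R) (E : forall n : nat, rel 'I_n -> Prop) : Prop :=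
  Un_cv (fun n => prob_G (m_of alpha beta n) (p_of alpha gamma n) (E n)) R1.

Definition somewhere_dense (alpha beta gamma : R) : Prop :=
  exists k : nat, forall t : nat,
    whp alpha beta gamma (fun n (e : rel 'I_n) => shallow_top_minor (@complete_rel t) e k).

(* The model has bounded expansion (f indexed by k = 2r). *)
Definition bounded_expansion (alpha beta gamma : R) : Prop :=
  exists f : nat -> R, forall k : nat,
    whp alpha beta gamma (fun n (e : rel 'I_n) => top_grad_le e k (f k)).

(* Main.v *)
Require Import Defs.
From Stdlib Require Import Reals Lra ClassicalEpsilon.
From HB Require Import structures.
From mathcomp Require Import all_boot.

(** The nodes sharing an attribute form a clique, and the neighbourhoods of the attributes
    are independent binomial sets.  For [alpha < 1] a single attribute already has about
    [gamma n^((1 - alpha)/2)] nodes; for [alpha = 1] a given attribute has at least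
    [log n / (4 log log n)] nodes with probability at least [c n^(-1/2)], so one of the
    [beta n] attributes does.  Both claims follow from such a clique.

    For [alpha > 1] a first moment bound shows that all attributes have at most [d] nodes,
    [d] a constant.  Let [H] be a dense shallow topological minor with [h] nails.  After
    shortcuts, the attributes along each subdivided edge are distinct, and an attribute
    serves at most [d^2] of these paths; hence a constant fraction of the paths, all of the
    same length, are pairwise attribute-disjoint.  Such a family of [q = C h] paths with [l]
    inner nodes uses [2 q (l + 1)] distinct edges of the bipartite graph.  As [n m p^2] is at
    most a constant, the expected number of such unordered families is at most
    [binomial(n, h) (K h^2 / n)^q / q!], and summing over [h] gives [O(1/n)]. *)

Set Implicit Arguments.
Unset Strict Implicit.
Unset Printing Implicit Defensive.

Local Open Scope R_scope.

(** * Expectations over the random bipartite graph *)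

Lemma Rplus_associative : associative Rplus.
Proof. by move=> x y z; ring. Qed.
Lemma Rmult_associative : associative Rmult.
Proof. by move=> x y z; ring. Qed.
Lemma Rmult_left_distributive : left_distributive Rmult Rplus.
Proof. by move=> x y z; ring. Qed.
Lemma Rmult_right_distributive : right_distributive Rmult Rplus.
Proof. by move=> x y z; ring. Qed.

HB.instance Definition _ :=
  Monoid.isComLaw.Build R 0 Rplus Rplus_associative Rplus_comm Rplus_0_l.
HB.instance Definition _ :=
  Monoid.isComLaw.Build R 1 Rmult Rmult_associative Rmult_comm Rmult_1_l.
HB.instance Definition _ := Monoid.isMulLaw.Build R 0 Rmult Rmult_0_l Rmult_0_r.
HB.instance Definition _ :=
  Monoid.isAddLaw.Build R Rmult Rplus Rmult_left_distributive Rmult_right_distributive.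

Definition indic (b : bool) : R := if b then 1 else 0.

Lemma indic_ge0 b : 0 <= indic b.
Proof. by case: b => /=; lra. Qed.

Lemma Rsum_le (I : Type) (r : seq I) (P : pred I) (F G : I -> R) :
  (forall i, P i -> F i <= G i) ->
  \big[Rplus/0]_(i <- r | P i) F i <= \big[Rplus/0]_(i <- r | P i) G i.
Proof.
move=> FG; elim/big_ind2: _ => [|x1 x2 y1 y2 ? ?|i Pi]; [lra|lra|exact: FG].
Qed.

Lemma Rsum_ge0 (I : Type) (r : seq I) (P : pred I) (F : I -> R) :
  (forall i, P i -> 0 <= F i) -> 0 <= \big[Rplus/0]_(i <- r | P i) F i.
Proof. by move=> F0; elim/big_ind: _ => [|x y ? ?|i Pi]; [lra|lra|exact: F0]. Qed.

Lemma Rprod_ge0 (I : Type) (r : seq I) (P : pred I) (F : I -> R) :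
  (forall i, P i -> 0 <= F i) -> 0 <= \big[Rmult/1]_(i <- r | P i) F i.
Proof.
move=> F0; elim/big_ind: _ => [|x y ? ?|i Pi]; [lra|exact: Rmult_le_pos|exact: F0].
Qed.

Lemma Rsum_term_le (I : finType) (P : pred I) (F : I -> R) i0 :
  P i0 -> (forall i, P i -> 0 <= F i) -> F i0 <= \big[Rplus/0]_(i | P i) F i.
Proof.
move=> Pi0 F0; rewrite (bigD1 i0) //=.
have := @Rsum_ge0 _ (index_enum I) (fun i => P i && (i != i0)) F.
by move=> /(_ (fun i H => F0 i (proj1 (andP H)))); lra.
Qed.

Lemma Rsum_const (I : finType) (P : pred I) c :
  \big[Rplus/0]_(i | P i) c = INR #|P| * c.
Proof.
rewrite big_const; elim: #|P| => [|j IH]; first by rewrite /=; ring.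
by rewrite iterS IH S_INR; ring.
Qed.

Lemma Rprod_const (I : finType) (P : pred I) c :
  \big[Rmult/1]_(i | P i) c = c ^ #|P|.
Proof. by rewrite big_const; elim: #|P| => [|j IH] //=; rewrite IH. Qed.

Lemma Rprod_bool (T : finType) (c : {ffun T -> bool}) x y :
  \big[Rmult/1]_t (if c t then x else y) =
  x ^ #|[set t | c t]| * y ^ (#|T| - #|[set t | c t]|).
Proof.
rewrite (bigID (fun t => c t)) /=.
rewrite (eq_bigr (fun=> x)); last by move=> i ->.
rewrite [X in _ * X](eq_bigr (fun=> y)); last by move=> i /negbTE ->.
rewrite !Rprod_const; congr (_ ^ _ * _ ^ _).
  by apply: eq_card => t; rewrite inE.
have -> : (#|T| - #|[set t | c t]|)%N = #|~: [set t | c t]| by rewrite [RHS]cardsCs setCK.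
by apply: eq_card => t; rewrite !inE.
Qed.

Definition wt (p : R) (b : bool) : R := if b then p else 1 - p.

Lemma bip_weightE n m p (B : bip n m) :
  bip_weight p B = \big[Rmult/1]_x wt p (B x).
Proof. by rewrite /wt Rprod_bool /bip_weight card_prod !card_ord. Qed.

Definition Ex n m p (F : bip n m -> R) : R :=
  \big[Rplus/0]_(B : bip n m) (bip_weight p B * F B).

Section Expectation.
Variables (n m : nat) (p : R).
Implicit Types (F G : bip n m -> R).

(** Independence of the edges: the weight is itself a product over the edges, so summing over all
    Boolean functions distributes edge by edge. *)
Lemma Ex_prod (g : 'I_n * 'I_m -> bool -> R) :
  Ex p (fun B : bip n m => \big[Rmult/1]_x g x (B x)) =
  \big[Rmult/1]_x (p * g x true + (1 - p) * g x false).
Proof.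
rewrite /Ex (eq_bigr (fun B : bip n m => \big[Rmult/1]_x (wt p (B x) * g x (B x)))).
2: by move=> B _; rewrite bip_weightE big_split.
rewrite -(bigA_distr_bigA (fun x b => wt p b * g x b)).
by apply: eq_bigr => x _; rewrite big_bool.
Qed.

Lemma Ex_1 : Ex p (fun _ : bip n m => 1) = 1.
Proof.
have -> : Ex p (fun _ : bip n m => 1) =
  Ex p (fun B : bip n m => \big[Rmult/1]_(x : 'I_n * 'I_m) 1).
  by apply: eq_bigr => B _; rewrite big1.
by rewrite (Ex_prod (fun _ _ => 1)) big1 // => x _; ring.
Qed.

Lemma ExD F G : Ex p (fun B => F B + G B) = Ex p F + Ex p G.
Proof. by rewrite /Ex -big_split; apply: eq_bigr => B _ /=; ring. Qed.

Lemma ExZ c F : Ex p (fun B => c * F B) = c * Ex p F.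
Proof. by rewrite /Ex big_distrr; apply: eq_bigr => B _ /=; ring. Qed.

Lemma Ex_sum (I : Type) (r : seq I) (P : pred I) (F : I -> bip n m -> R) :
  Ex p (fun B => \big[Rplus/0]_(i <- r | P i) F i B) =
  \big[Rplus/0]_(i <- r | P i) Ex p (F i).
Proof.
by rewrite /Ex exchange_big; apply: eq_bigr => B _; rewrite big_distrr.
Qed.

Lemma Ex_subset (Z : {set 'I_n * 'I_m}) :
  Ex p (fun B : bip n m => indic [forall x in Z, B x]) = p ^ #|Z|.
Proof.
(* Outside [Z] this factor is constantly 1, and its average is p + (1 - p) = 1. *)
pose g x (b : bool) := indic (~~ (x \in Z) || b).
have -> : Ex p (fun B : bip n m => indic [forall x in Z, B x]) =
  Ex p (fun B : bip n m => \big[Rmult/1]_x g x (B x)).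
  apply: eq_bigr => B _; congr (_ * _); rewrite /g /indic.
  case: ifP => [/forall_inP ZB|/negbT].
    rewrite big1 // => x _; case xZ: (x \in Z) => //=; by rewrite ZB.
  rewrite negb_forall_in => /exists_inP[x xZ /negbTE Bx].
  by rewrite (bigD1 x) //= xZ Bx /= Rmult_0_l.
rewrite Ex_prod (bigID (fun x => x \in Z)) /= [X in _ * X]big1.
  rewrite (eq_bigr (fun=> p)) ?Rprod_const; first by rewrite Rmult_1_r.
  by move=> x xZ; rewrite /g xZ /=; ring.
by move=> x /negbTE xZ; rewrite /g xZ /=; ring.
Qed.

(** The columns of [B], that is the neighbourhoods of the attributes, are independent and
    identically distributed; currying [B] turns the sum into one over families of columns. *)
Lemma Ex_cols (g : {ffun 'I_n -> bool} -> R) :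
  Ex p (fun B : bip n m => \big[Rmult/1]_a g [ffun v => B (v, a)]) =
  (\big[Rplus/0]_(c : {ffun 'I_n -> bool}) (\big[Rmult/1]_v wt p (c v) * g c)) ^ m.
Proof.
pose un (c : {ffun 'I_m -> {ffun 'I_n -> bool}}) : bip n m := [ffun x => c x.2 x.1].
pose cu (B : bip n m) : {ffun 'I_m -> {ffun 'I_n -> bool}} := [ffun a => [ffun v => B (v, a)]].
rewrite /Ex (reindex un); last first.
  exists cu => [c _|B _]; last by apply/ffunP => -[v a]; rewrite !ffunE.
  by apply/ffunP => a; apply/ffunP => v; rewrite !ffunE.
have -> : forall x, x ^ m = \big[Rmult/1]_(a < m) x by move=> x; rewrite Rprod_const card_ord.
rewrite (bigA_distr_bigA (fun a (c : {ffun 'I_n -> bool}) => \big[Rmult/1]_v wt p (c v) * g c)).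
apply: eq_bigr => c _; rewrite big_split /=; congr (_ * _).
  rewrite bip_weightE exchange_big pair_big /=.
  by apply: eq_bigr => -[v a] _; rewrite ffunE.
apply: eq_bigr => a _; congr g; apply/ffunP => v; by rewrite !ffunE.
Qed.

Hypothesis p01 : 0 <= p <= 1.

Lemma wt_ge0 b : 0 <= wt p b.
Proof. by rewrite /wt; case: b; lra. Qed.

Lemma bip_weight_ge0 (B : bip n m) : 0 <= bip_weight p B.
Proof. by rewrite bip_weightE; apply: Rprod_ge0 => x _; apply: wt_ge0. Qed.

Lemma Ex_le F G : (forall B, F B <= G B) -> Ex p F <= Ex p G.
Proof.
move=> FG; apply: Rsum_le => B _; apply: Rmult_le_compat_l => //.
exact: bip_weight_ge0.
Qed.

Lemma prob_GE (E : rel 'I_n -> Prop) :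
  prob_G m p E =
  Ex p (fun B : bip n m => if excluded_middle_informative (E (rig_adj B)) then 1 else 0).
Proof.
by apply: eq_bigr => B _; case: excluded_middle_informative => ? /=; ring.
Qed.

Lemma prob_G_le1 (E : rel 'I_n -> Prop) : prob_G m p E <= 1.
Proof.
rewrite prob_GE -[X in _ <= X]Ex_1; apply: Ex_le => B.
by case: excluded_middle_informative => ? /=; lra.
Qed.

(** First moment method: [F] dominates the indicator of failure. *)
Lemma prob_G_ge (E : rel 'I_n -> Prop) F :
  (forall B, 0 <= F B) -> (forall B, ~ E (rig_adj B) -> 1 <= F B) ->
  1 - Ex p F <= prob_G m p E.
Proof.
move=> F0 F1; rewrite prob_GE.
apply: (Rle_trans _ (Ex p (fun B : bip n m => 1 + (-1) * F B))).
  by rewrite ExD ExZ Ex_1; lra.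
apply: Ex_le => B; have := F0 B; have := F1 B.
by case: excluded_middle_informative => [? _|nE /(_ nE)] /=; lra.
Qed.

End Expectation.

(** * Attribute cliques and binomial estimates *)

Definition nbhd n m (B : bip n m) (a : 'I_m) : {set 'I_n} := [set v | B (v, a)].

Lemma nbhd_adj n m (B : bip n m) a u v :
  u \in nbhd B a -> v \in nbhd B a -> u != v -> rig_adj B u v.
Proof.
rewrite !inE /rig_adj => uB vB ->.
by apply/existsP; exists a; rewrite uB vB.
Qed.

(** The neighbourhood is a clique, so any [t] of its nodes serve as nails joined by direct edges. *)
Lemma complete_minor_of_nbhd n m (B : bip n m) a t :
  (t <= #|nbhd B a|)%N -> shallow_top_minor (@complete_rel t) (rig_adj B) 0.
Proof.
move=> tle; pose nail (i : 'I_t) := enum_val (widen_ord tle i).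
have nail_inj : injective nail.
  by move=> i j /enum_val_inj /(congr1 val) /= ij; apply: val_inj.
exists nail, (fun _ _ => [::]); split => //; split=> // i j _ ij; split => //=.
rewrite andbT; apply: nbhd_adj; [exact: enum_valP|exact: enum_valP|].
by apply: contra ij => /eqP/nail_inj ->.
Qed.

Lemma leq_bigmin (I : finType) (P : pred I) (F : I -> nat) x y :
  (y <= x)%N -> (forall i, P i -> y <= F i)%N -> (y <= \big[minn/x]_(i | P i) F i)%N.
Proof.
by move=> yx yF; elim/big_ind: _ => // a b ya yb; rewrite leq_min ya yb.
Qed.

Lemma degeneracy_ge_nbhd n m (B : bip n m) a :
  (#|nbhd B a| <= (degeneracy (rig_adj B)).+1)%N.
Proof.
have [->|N0] := eqVneq (nbhd B a) set0; first by rewrite cards0.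
have deg : (mindeg (rig_adj B) (nbhd B a) <= degeneracy (rig_adj B))%N.
  exact: (bigmax_sup (nbhd B a)).
rewrite -ltnS in deg; apply: leq_trans deg.
rewrite -[X in (X <= _)%N]prednK ?card_gt0 // !ltnS.
(* The default value of the minimum in [mindeg] is n, which exceeds the clique degree. *)
apply: leq_bigmin; first by rewrite (leq_trans (leq_pred _)) ?max_card.
move=> v vN; rewrite (cardsD1 v (nbhd B a)) vN /=; apply: subset_leq_card.
apply/subsetP => u; rewrite in_setD1 => /andP[uv uN].
by rewrite inE uN (nbhd_adj vN uN) // eq_sym.
Qed.

(** The lower tail of the binomial law, summed over outcomes so as to match the factor in
    [Ex_cols]. *)
Definition bin_lt (n : nat) (p : R) (k : nat) : R :=
  \big[Rplus/0]_(c : {ffun 'I_n -> bool})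
    (\big[Rmult/1]_v wt p (c v) * indic (#|[set v | c v]| < k)%N).

(** Failure forces all [m] independent neighbourhoods to be smaller than [k]. *)
Lemma prob_G_nbhd n m p k (E : rel 'I_n -> Prop) : 0 <= p <= 1 ->
  (forall (B : bip n m) a, (k <= #|nbhd B a|)%N -> E (rig_adj B)) ->
  1 - bin_lt n p k ^ m <= prob_G m p E.
Proof.
move=> p01 kE; rewrite /bin_lt -Ex_cols; apply: prob_G_ge => // B.
  by apply: Rprod_ge0 => a _; apply: indic_ge0.
move=> nE; right; rewrite big1 // => a _.
rewrite (_ : [set _ | _] = nbhd B a); last by apply/setP => v; rewrite !inE ffunE.
by case: ltnP => // /kE.
Qed.

Lemma sum_ffun_bool n x y :
  \big[Rplus/0]_(c : {ffun 'I_n -> bool}) \big[Rmult/1]_v (if c v then x else y) =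
  (x + y) ^ n.
Proof.
rewrite -(bigA_distr_bigA (fun _ b => if b then x else y)).
by rewrite (eq_bigr (fun=> x + y)) ?Rprod_const ?card_ord // => i _; rewrite big_bool.
Qed.

Lemma bin_lt_ge0 n p k : 0 <= p <= 1 -> 0 <= bin_lt n p k.
Proof.
move=> p01; apply: Rsum_ge0 => c _; apply: Rmult_le_pos; last exact: indic_ge0.
by apply: Rprod_ge0 => v _; apply: wt_ge0.
Qed.

(* Markov's inequality for [2 ^ - X], where [X] is binomial. *)
Lemma bin_lt_chernoff n p k : 0 <= p <= 1 -> bin_lt n p k <= 2 ^ k * (1 - p / 2) ^ n.
Proof.
move=> p01; have -> : 1 - p / 2 = p / 2 + (1 - p) by field.
rewrite -sum_ffun_bool big_distrr; apply: Rsum_le => c _.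
have -> : \big[Rmult/1]_v (if c v then p / 2 else 1 - p) =
    \big[Rmult/1]_v wt p (c v) * (/ 2) ^ #|[set v | c v]|.
  by rewrite /wt !Rprod_bool Rpow_mult_distr !Rmult_assoc; congr (_ * _); rewrite Rmult_comm.
rewrite [X in _ <= X]/= -Rmult_assoc [2 ^ k * _]Rmult_comm Rmult_assoc.
apply: Rmult_le_compat_l; first by apply: Rprod_ge0 => v _; apply: wt_ge0.
rewrite /indic; case: ltnP => [ck|_].
  rewrite -(Rinv_r (2 ^ k)); last by apply: pow_nonzero; lra.
  apply: Rmult_le_compat_l; first by apply: pow_le; lra.
  rewrite pow_inv; apply: Rinv_le_contravar; first by apply: pow_lt; lra.
  by apply: Rle_pow; [lra|apply/leP/ltnW].
by apply: Rmult_le_pos; apply: pow_le; lra.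
Qed.

(** The events of fewer than [k] and of exactly [k] successes are disjoint. *)
Lemma bin_lt_point n p k : 0 <= p <= 1 ->
  bin_lt n p k <= 1 - INR 'C(n, k) * (p ^ k * (1 - p) ^ (n - k)).
Proof.
move=> p01.
pose Q := [pred c : {ffun 'I_n -> bool} | #|[set v | c v]| == k].
have tot : \big[Rplus/0]_(c : {ffun 'I_n -> bool}) \big[Rmult/1]_v wt p (c v) = 1.
  by rewrite sum_ffun_bool (_ : p + (1 - p) = 1) ?pow1 //; ring.
have QE : \big[Rplus/0]_(c | Q c) \big[Rmult/1]_v wt p (c v) =
    INR #|Q| * (p ^ k * (1 - p) ^ (n - k)).
  rewrite -Rsum_const; apply: eq_bigr => c /eqP cQ.
  by rewrite /wt Rprod_bool cQ card_ord.
have CQ : INR 'C(n, k) <= INR #|Q|.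
  apply/le_INR/leP; rewrite -[X in 'C(X, _)]card_ord -card_draws.
  pose f (A : {set 'I_n}) := [ffun v => v \in A].
  have fE A : [set v | f A v] = A by apply/setP => v; rewrite inE ffunE.
  rewrite -(@card_imset _ _ f); last by move=> A A' AA'; rewrite -(fE A) AA' fE.
  apply: subset_leq_card; apply/subsetP => _ /imsetP[A + ->].
  by rewrite !inE fE.
have w0 : 0 <= p ^ k * (1 - p) ^ (n - k) by apply: Rmult_le_pos; apply: pow_le; lra.
have := Rmult_le_compat_r _ _ _ w0 CQ; rewrite -QE.
suff : bin_lt n p k + \big[Rplus/0]_(c | Q c) \big[Rmult/1]_v wt p (c v) <= 1 by lra.
rewrite -[X in _ <= X]tot big_mkcond /bin_lt -big_split; apply: Rsum_le => c _ /=.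
have : 0 <= \big[Rmult/1]_v wt p (c v) by apply: Rprod_ge0 => v _; apply: wt_ge0.
by rewrite /Q /= /indic; case: ltngtP => _ /=; lra.
Qed.

Lemma INR_expn a b : INR (a ^ b)%N = INR a ^ b.
Proof.
elim: b => [|b IH]; first by rewrite expn0.
by rewrite expnS -multE mult_INR IH.
Qed.

Lemma leq_ffact_exp n k : (n ^_ k <= n ^ k)%N.
Proof.
elim: k n => [|k IH] n; first by rewrite expn0.
rewrite ffactnS expnS leq_mul2l; apply/orP; right.
apply: leq_trans (IH _) _; case: k {IH} => [|k]; first by rewrite !expn0.
by rewrite leq_exp2r // leq_pred.
Qed.

Lemma geq_ffact_exp n k : ((n.+1 - k) ^ k <= n ^_ k)%N.
Proof.
case: (leqP n.+1 k) => [nk|].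
  by case: k nk => [|k] // nk; rewrite (eqP nk) exp0n.
elim: k n => [|k IH] n kn; first by rewrite expn0.
case: n kn => // n kn; rewrite ffactnS expnS subSS.
apply: leq_mul; first by rewrite (leq_trans (leq_subr _ _)).
by apply: IH.
Qed.

Lemma bin_le_pow n h : INR 'C(n, h) * INR h`! <= INR n ^ h.
Proof.
rewrite -mult_INR multE bin_ffact -INR_expn; apply/le_INR/leP.
exact: leq_ffact_exp.
Qed.

Lemma fact_leq_exp k : (k`! <= k ^ k)%N.
Proof. by rewrite -ffactnn leq_ffact_exp. Qed.

(** Every factor of the falling factorial is at least n / 2, and the denominator is at most k^k. *)
Lemma bin_ge_pow n k : (k + k <= n)%N -> (INR n / (2 * INR k)) ^ k <= INR 'C(n, k).
Proof.
case: k => [|k] kn; first by rewrite bin0 /=; lra.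
have k0 : 0 < INR k.+1 by apply: lt_0_INR; apply/ltP.
have -> : INR n / (2 * INR k.+1) = (INR n / 2) / INR k.+1 by field; lra.
rewrite [X in X ^ _]/Rdiv Rpow_mult_distr pow_inv.
apply: (Rmult_le_reg_r (INR k.+1 ^ k.+1)); first exact: pow_lt.
rewrite Rmult_assoc Rinv_l ?Rmult_1_r; last by apply: pow_nonzero; lra.
apply: (Rle_trans _ (INR (n ^_ k.+1))); last first.
  rewrite -bin_ffact -multE mult_INR -INR_expn.
  apply: Rmult_le_compat_l; first exact: pos_INR.
  by apply/le_INR/leP/fact_leq_exp.
apply: (Rle_trans _ (INR ((n.+1 - k.+1) ^ k.+1)%N)); last first.
  by apply/le_INR/leP/geq_ffact_exp.
rewrite INR_expn; apply: pow_incr; split; first by have := pos_INR n; lra.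
rewrite subSS -minusE minus_INR; last by apply/leP; rewrite (leq_trans _ kn) // addSn leqW // leq_addr.
have := le_INR _ _ (elimT leP kn); rewrite -plusE plus_INR !S_INR; lra.
Qed.

(** A weak Stirling bound; the induction step is (1 + 1/x)^x <= e <= 3. *)
Lemma pow_le_fact N : INR N ^ N <= 3 ^ N * INR N`!.
Proof.
elim: N => [|N IH]; first by rewrite fact0 /=; lra.
case: N IH => [_|N IH]; first by rewrite factS fact0 /=; lra.
set x := INR N.+1 in IH; have x0 : 0 < x by apply: lt_0_INR; apply/ltP.
have step : INR N.+2 ^ N.+1 <= 3 * x ^ N.+1.
  have -> : INR N.+2 = x * (1 + / x) by rewrite S_INR -/x; field; lra.
  rewrite Rpow_mult_distr Rmult_comm; apply: Rmult_le_compat_r.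
    by apply: pow_le; lra.
  apply: (Rle_trans _ (exp (/ x) ^ N.+1)).
    apply: pow_incr; split; last by have := exp_ineq1_le (/ x); lra.
    by have := Rinv_0_lt_compat _ x0; lra.
  rewrite -Rpower_pow; last exact: exp_pos.
  rewrite /Rpower ln_exp -/x Rinv_r; last by lra.
  exact: exp_le_3.
have -> : INR N.+2 ^ N.+2 = INR N.+2 * INR N.+2 ^ N.+1 by [].
rewrite factS -multE mult_INR.
have -> : 3 ^ N.+2 * (INR N.+2 * INR (N.+1)`!) =
  INR N.+2 * (3 * (3 ^ N.+1 * INR (N.+1)`!)) by rewrite /=; ring.
apply: Rmult_le_compat_l; first exact: pos_INR.
by lra.
Qed.

(** * Asymptotics for [alpha <= 1] *)

Definition ev (P : nat -> Prop) : Prop := exists N, forall n, (N <= n)%N -> P n.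

Lemma ev_and (P Q : nat -> Prop) : ev P -> ev Q -> ev (fun n => P n /\ Q n).
Proof.
move=> [N1 H1] [N2 H2]; exists (maxn N1 N2) => n; rewrite geq_max => /andP[? ?].
by split; [apply: H1|apply: H2].
Qed.

Lemma ev_imp (P Q : nat -> Prop) : (forall n, P n -> Q n) -> ev P -> ev Q.
Proof. by move=> PQ [N H]; exists N => n /H /PQ. Qed.

Lemma ev_INR M : ev (fun n => M <= INR n).
Proof.
have [N NM] := INR_unbounded M; exists N => n /leP/le_INR; lra.
Qed.

Lemma ev_ln M : ev (fun n => M <= ln (INR n)).
Proof.
apply: ev_imp (ev_INR (exp M)) => n Mn; rewrite -[M]ln_exp.
have M0 := exp_pos M; case: Mn => [Mn|->]; last by lra.
by left; apply: ln_increasing.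
Qed.

Lemma ev_lnln M : ev (fun n => M <= ln (ln (INR n))).
Proof.
apply: ev_imp (ev_ln (exp M)) => n Mn; rewrite -[M]ln_exp.
have M0 := exp_pos M; case: Mn => [Mn|->]; last by lra.
by left; apply: ln_increasing.
Qed.

Lemma ev_Rpower a M : 0 < a -> ev (fun n => M <= Rpower (INR n) a).
Proof.
move=> a0; apply: ev_imp (ev_ln (M / a)) => n Mn.
have := exp_ineq1_le (a * ln (INR n)); rewrite -/(Rpower _ _).
have := Rmult_le_compat_l _ _ _ (Rlt_le _ _ a0) Mn.
have -> : a * (M / a) = M by field; lra.
by lra.
Qed.

Lemma Rpower_gt0 x y : 0 < Rpower x y.
Proof. exact: exp_pos. Qed.

(** Same shape as the body of [m_of], so that [nfloor_bounds] applies there by conversion. *)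
Definition nfloor (x : R) : nat := Z.to_nat (Int_part x).

Lemma nfloor_bounds x : 0 <= x -> x - 1 < INR (nfloor x) <= x.
Proof.
move=> x0; have [h1 h2] := base_Int_part x.
have z0 : (0 <= Int_part x)%Z.
  by apply/BinInt.Z.lt_succ_r; apply: lt_IZR; rewrite succ_IZR; lra.
by rewrite /nfloor INR_IZR_INZ Znat.Z2Nat.id //; lra.
Qed.

(** * Growth of m and p, and transfer from cliques to limits *)

Section Model.
Variables (alpha beta gamma : R).
Hypotheses (alpha0 : 0 < alpha) (beta0 : 0 < beta) (gamma0 : 0 < gamma).

Lemma m_of_bounds n :
  beta * Rpower (INR n) alpha - 1 < INR (m_of alpha beta n) <= beta * Rpower (INR n) alpha.
Proof.
apply: nfloor_bounds; apply: Rmult_le_pos; first by lra.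
exact/Rlt_le/Rpower_gt0.
Qed.

Lemma ev_m_of M : ev (fun n => M <= INR (m_of alpha beta n)).
Proof.
apply: ev_imp (ev_Rpower ((M + 1) / beta) alpha0) => n Mn.
have [h _] := m_of_bounds n.
have := Rmult_le_compat_l _ _ _ (Rlt_le _ _ beta0) Mn.
have -> : beta * ((M + 1) / beta) = M + 1 by field; lra.
by lra.
Qed.

Lemma p_of_gt0 n : 0 < p_of alpha gamma n.
Proof. by apply: Rmult_lt_0_compat => //; apply: Rpower_gt0. Qed.

Lemma ev_p_of e : 0 < e -> ev (fun n => p_of alpha gamma n <= e).
Proof.
move=> e0; have h : 0 < (1 + alpha) / 2 by lra.
apply: ev_imp (ev_Rpower (gamma / e) h) => n Mn.
rewrite /p_of Rpower_Ropp; have P0 := Rpower_gt0 (INR n) ((1 + alpha) / 2).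
apply: (Rmult_le_reg_r (Rpower (INR n) ((1 + alpha) / 2))) => //.
rewrite Rmult_assoc Rinv_l; last by lra.
have := Rmult_le_compat_l _ _ _ (Rlt_le _ _ e0) Mn.
have -> : e * (gamma / e) = gamma by field; lra.
by lra.
Qed.

Lemma ev_p01 : ev (fun n => 0 <= p_of alpha gamma n <= 1).
Proof.
apply: ev_imp (ev_p_of Rlt_0_1) => n ?.
by have := p_of_gt0 n; lra.
Qed.

Lemma INR_p_of n : (0 < n)%N ->
  INR n * p_of alpha gamma n = gamma * Rpower (INR n) ((1 - alpha) / 2).
Proof.
move=> n0; have n0' : 0 < INR n by apply: lt_0_INR; apply/ltP.
rewrite /p_of -{1}[INR n]Rpower_1 // Rmult_comm Rmult_assoc -Rpower_plus.
by congr (_ * Rpower _ _); field.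
Qed.

(** Since probabilities are at most 1, only the lower estimate matters; halving [eps] yields the
    strict inequality of [Un_cv]. *)
Lemma whp_intro (E : forall n : nat, rel 'I_n -> Prop) :
  (forall eps, 0 < eps ->
    ev (fun n => 1 - eps <= prob_G (m_of alpha beta n) (p_of alpha gamma n) (@E n))) ->
  whp alpha beta gamma E.
Proof.
move=> H eps eps0.
have eps2 : 0 < eps / 2 by lra.
have [N HN] := ev_and ev_p01 (H _ eps2).
exists N => n /leP /HN [p01 Hn].
rewrite /Rdist; apply: Rabs_def1; last by lra.
by have := prob_G_le1 (m_of alpha beta n) p01 (@E n); lra.
Qed.

Section Cliques.
Variable k : nat -> nat.
Hypothesis k_small : forall eps, 0 < eps ->
  ev (fun n => bin_lt n (p_of alpha gamma n) (k n) ^ m_of alpha beta n <= eps).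

(** By [k_small], with high probability some attribute has at least [k n] nodes; both claims for
    alpha <= 1 are consequences of such an attribute. *)
Lemma whp_nbhd (E : forall n : nat, rel 'I_n -> Prop) :
  ev (fun n => forall m (B : bip n m) a, (k n <= #|nbhd B a|)%N -> E n (rig_adj B)) ->
  whp alpha beta gamma E.
Proof.
move=> kE; apply: whp_intro => eps eps0.
apply: ev_imp (ev_and ev_p01 (ev_and kE (k_small eps0))) => n [p01 [kEn small]].
have := prob_G_nbhd p01 (kEn (m_of alpha beta n)); lra.
Qed.

Lemma somewhere_dense_nbhd :
  (forall t : nat, ev (fun n => (t <= k n)%N)) -> somewhere_dense alpha beta gamma.
Proof.
move=> tk; exists 0%N => t; apply: whp_nbhd; apply: ev_imp (tk t) => n tn m B a kB.
exact: complete_minor_of_nbhd (leq_trans tn kB).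
Qed.

Lemma degeneracy_nbhd (f : nat -> R) :
  ev (fun n => f n + 1 <= INR (k n)) ->
  whp alpha beta gamma (fun n (e : rel 'I_n) => f n <= INR (degeneracy e)).
Proof.
move=> fk; apply: whp_nbhd; apply: ev_imp fk => n fn m B a kB.
have /leP/le_INR := leq_trans kB (degeneracy_ge_nbhd B a).
by rewrite S_INR; lra.
Qed.

End Cliques.

Lemma ev_leq_INR (k : nat -> nat) (t : nat) :
  ev (fun n => INR t <= INR (k n)) -> ev (fun n => (t <= k n)%N).
Proof. by apply: ev_imp => n /INR_le/leP. Qed.

(** With [mu] = np, the Chernoff bound is at most exp(k - mu / 2), which tends to 0 for k close to
    mu / 4. *)
Lemma case_lt1 : alpha < 1 ->
  somewhere_dense alpha beta gamma /\
  exists c : R, 0 < c /\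
    whp alpha beta gamma (fun n (e : rel 'I_n) =>
      c * gamma * Rpower (INR n) ((1 - alpha) / 2) <= INR (degeneracy e)).
Proof.
move=> alpha1; have h : 0 < (1 - alpha) / 2 by lra.
pose mu n := gamma * Rpower (INR n) ((1 - alpha) / 2).
have mu0 n : 0 < mu n by apply: Rmult_lt_0_compat => //; apply: Rpower_gt0.
have ev_mu M : ev (fun n => M <= mu n).
  apply: ev_imp (ev_Rpower (M / gamma) h) => n Mn.
  have := Rmult_le_compat_l _ _ _ (Rlt_le _ _ gamma0) Mn.
  by have -> : gamma * (M / gamma) = M by field; lra.
(* One unit repairs the floor, the other pays for the gap between clique size and degeneracy. *)
pose k n := (nfloor (mu n / 4)).+2.
have kb n : mu n / 4 + 1 <= INR (k n) <= mu n / 4 + 2.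
  have := @nfloor_bounds (mu n / 4); rewrite /k !S_INR; have := mu0 n; lra.
have small eps : 0 < eps ->
    ev (fun n => bin_lt n (p_of alpha gamma n) (k n) ^ m_of alpha beta n <= eps).
  (* Capping at 1 gives b^m <= b once b <= e and m >= 1. *)
  move=> eps0; pose e := Rmin eps 1.
  have e0 : 0 < e by apply: Rmin_glb_lt; lra.
  have [e_eps e_1] : e <= eps /\ e <= 1 by split; [apply: Rmin_l|apply: Rmin_r].
  (* The exponent is at most mu / 4 + 2 - mu / 2, hence at most ln e from this value of [mu] on. *)
  have := ev_and ev_p01 (ev_and (ev_m_of 1) (ev_and (ev_INR 1) (ev_mu (4 * (2 - ln e))))).
  apply: ev_imp => n [p01 [m1 [n1 mun]]].
  set b := bin_lt _ _ _; suff be : b <= e.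
    have b0 : 0 <= b by apply: bin_lt_ge0.
    case: (m_of _ _ _) m1 => [|m] /= m1; first by lra.
    have : b ^ m <= 1 by rewrite -(pow1 m); apply: pow_incr; lra.
    move=> bm; have := Rmult_le_compat_l _ _ _ b0 bm; lra.
  apply: (Rle_trans _ _ _ (bin_lt_chernoff _ _ p01)).
  have n0 : (0 < n)%N by apply/ltP/INR_lt; rewrite /=; lra.
  have npE := INR_p_of n0; set p := p_of _ _ _ in npE p01 *.
  apply: (Rle_trans _ (exp (INR (k n)) * exp (- (mu n / 2)))).
    apply: Rmult_le_compat; try by apply: pow_le; lra.
      rewrite -[X in exp X]Rmult_1_r -/(Rpower (exp 1) _).
      have -> : exp (INR (k n) * 1) = exp 1 ^ k n.
        by rewrite -Rpower_pow ?/Rpower ?ln_exp //; apply: exp_pos.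
      by apply: pow_incr; have := exp_ineq1_le 1; lra.
    have -> : - (mu n / 2) = INR n * - (p / 2) by rewrite /mu -npE; field.
    have -> : exp (INR n * - (p / 2)) = exp (- (p / 2)) ^ n.
      by rewrite -Rpower_pow ?/Rpower ?ln_exp //; apply: exp_pos.
    by apply: pow_incr; have := exp_ineq1_le (- (p / 2)); lra.
  rewrite -exp_plus -[X in _ <= X]exp_ln //.
  have [_ kn] := kb n.
  have : INR (k n) + - (mu n / 2) <= ln e by lra.
  by case=> [?|->]; [left; apply: exp_increasing|right].
split.
  apply: (somewhere_dense_nbhd small) => t; apply: ev_leq_INR.
  apply: ev_imp (ev_mu (4 * INR t)) => n ?.
  by have := kb n; lra.
exists (/ 4); split; first by lra.
apply: (degeneracy_nbhd small); exists 0%N => n _.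
have := kb n; rewrite /mu; lra.
Qed.

End Model.

(** Here np = gamma is constant, so a large neighbourhood is rare: having exactly k nodes has
    probability at least (gamma / 2k)^k (1 - p)^n, of order at least n^(-1/2) for the chosen k.
    About beta n independent trials leave a failure probability of at most exp(- c n^(1/2)). *)
Lemma case_eq1 (beta gamma : R) : 0 < beta -> 0 < gamma ->
  somewhere_dense 1 beta gamma /\
  exists c : R, 0 < c /\
    whp 1 beta gamma (fun n (e : rel 'I_n) =>
      c * (ln (INR n) / ln (ln (INR n))) <= INR (degeneracy e)).
Proof.
move=> beta0 gamma0; have a0 := Rlt_0_1.
pose L n := ln (INR n); pose x n := ln (L n).
pose k n := (nfloor (/ 4 * (L n / x n))).+2.
have evx M : ev (fun n => M <= x n /\ L n = exp (x n)).
  apply: ev_imp (ev_and (ev_lnln M) (ev_ln 1)) => n [? L1]; split => //.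
  by rewrite /x exp_ln // /L; lra.
(* From x >= 32 follows L / x >= x / 4 >= 8, which absorbs the rounding in 2 k <= L / x. *)
have kb : ev (fun n => 32 <= x n /\ x n * x n / 4 <= L n /\
    / 4 * (L n / x n) + 1 <= INR (k n) <= / 4 * (L n / x n) + 2).
  apply: ev_imp (evx 32) => n [x32 Lx].
  have Lq : x n * x n / 4 <= L n.
    have -> : L n = exp (x n / 2) * exp (x n / 2) by rewrite -exp_plus Lx; congr exp; field.
    have := exp_ineq1_le (x n / 2) => e1.
    by have := Rmult_le_compat _ _ _ _ (_ : 0 <= x n / 2) (_ : 0 <= x n / 2)
      (_ : x n / 2 <= exp (x n / 2)) (_ : x n / 2 <= exp (x n / 2)); lra.
  split => //; split => //.
  have q0 : 0 <= / 4 * (L n / x n).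
    apply: Rmult_le_pos; first by lra.
    apply: Rmult_le_pos; last by left; apply: Rinv_0_lt_compat; lra.
    by rewrite Lx; left; apply: exp_pos.
  by have := nfloor_bounds q0; rewrite /k !S_INR; lra.
have Lxx n : 32 <= x n -> x n * x n / 4 <= L n -> x n / 4 <= L n / x n.
  move=> x32 Lq; apply: (Rmult_le_reg_r (x n)); first by lra.
  have -> : L n / x n * x n = L n by field; lra.
  by lra.
have small eps : 0 < eps ->
    ev (fun n => bin_lt n (p_of 1 gamma n) (k n) ^ m_of 1 beta n <= eps).
  (* Lower bound for (1 - p)^n, from 1 - p >= exp(- 2 p) when p <= 1/2 and np = gamma. *)
  move=> eps0; pose c0 := exp (- (2 * gamma)).
  have c00 : 0 < c0 by apply: exp_pos.
  have half : 0 < / 2 by lra.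
  (* The threshold 2 / beta gives beta n - 1 >= beta n / 2, the bound on n^(1/2) makes the final
     exponent at most ln eps, and x >= 1 / gamma gives L / x <= gamma L. *)
  have := ev_and (ev_p_of gamma a0 half) (ev_and (ev_INR (Rmax 16 (2 / beta)))
    (ev_and (ev_Rpower (- ln eps / (beta / 2 * c0)) half) (ev_and kb (evx (/ gamma))))).
  apply: ev_imp => n [p2 [n16 [npow [[x32 [Lq [k1 k2]]] [xg Lx]]]]].
  have n16' : 16 <= INR n by have := Rmax_l 16 (2 / beta); lra.
  have nb : 2 / beta <= INR n by have := Rmax_r 16 (2 / beta); lra.
  have n0 : 0 < INR n by lra.
  have p0 := p_of_gt0 1 gamma0 n; set p := p_of _ _ _ in p0 p2 *.
  have p01 : 0 <= p <= 1 by lra.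
  have pE : p = gamma / INR n.
    rewrite /p /p_of (_ : (1 + 1) / 2 = 1); last by field.
    by rewrite Rpower_Ropp Rpower_1.
  have nL : INR n = exp (L n) by rewrite exp_ln.
  have kL : 2 * INR (k n) <= L n / x n by have := Lxx _ x32 Lq; lra.
  have LxL : L n / x n * x n = L n by field; lra.
  have K0 : 0 < INR (k n) by apply: lt_0_INR; apply/ltP.
  have kn : (k n + k n <= n)%N.
    apply/leP/INR_le; rewrite plus_INR.
    have : L n / x n <= L n.
      by rewrite -[X in _ <= X]LxL; have := Lxx _ x32 Lq; nra.
    by have := exp_ineq1_le (L n); lra.
  have pt := bin_lt_point n (k n) p01.
  have b0 := bin_lt_ge0 n (k n) p01.
  set b := bin_lt _ _ _ in pt b0 *.
  have key : c0 * Rpower (INR n) (- / 2) <= INR 'C(n, k n) * (p ^ k n * (1 - p) ^ (n - k n)).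
    apply: (Rle_trans _ ((gamma / (2 * INR (k n))) ^ k n * (1 - p) ^ n)); last first.
      rewrite -Rmult_assoc; apply: Rmult_le_compat; try by apply: pow_le; lra.
      - by apply: pow_le; left; apply: Rdiv_lt_0_compat; lra.
      - have -> : gamma / (2 * INR (k n)) = INR n / (2 * INR (k n)) * p.
          by rewrite pE; field; lra.
        rewrite Rpow_mult_distr; apply: Rmult_le_compat_r; first by apply: pow_le; lra.
        exact: bin_ge_pow.
      - have -> : (1 - p) ^ n = (1 - p) ^ (n - k n) * (1 - p) ^ k n.
          by rewrite -pow_add plusE subnK // (leq_trans (leq_addr _ _) kn).
        rewrite -[X in _ <= X]Rmult_1_r; apply: Rmult_le_compat_l.
          by apply: pow_le; lra.
        by rewrite -[X in _ <= X](pow1 (k n)); apply: pow_incr; lra.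
    rewrite Rmult_comm; apply: Rmult_le_compat; try exact/Rlt_le/exp_pos.
      set y := gamma / _; have y0 : 0 < y by apply: Rdiv_lt_0_compat; lra.
      rewrite -Rpower_pow // /Rpower.
      suff H : - / 2 * L n <= INR (k n) * ln y.
        by case: H => [?|<-]; [left; apply: exp_increasing|right].
      (* Since 2 k <= L / x <= gamma L, the base y = gamma / (2 k) is at least 1 / L = exp(- x);
         then k x <= L / 2 gives y^k >= n^(-1/2). *)
      have lny : - x n <= ln y.
        rewrite -(ln_exp (- x n)).
        have H : exp (- x n) <= y.
          rewrite exp_Ropp -Lx /y; apply: (Rmult_le_reg_l (L n)); first by rewrite Lx; apply: exp_pos.
          have L0 : 0 < L n by rewrite Lx; apply: exp_pos.
          rewrite Rinv_r; last by lra.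
          apply: (Rmult_le_reg_r (2 * INR (k n))); first by lra.
          have -> : L n * (gamma / (2 * INR (k n))) * (2 * INR (k n)) = gamma * L n by field; lra.
          have : / gamma * gamma <= x n * gamma by apply: Rmult_le_compat_r; lra.
          rewrite Rinv_l; last by lra.
          move=> h; have : L n / x n <= gamma * L n.
            apply: (Rmult_le_reg_r (x n)); first by lra.
            by rewrite LxL; nra.
          by lra.
        case: H => [?|->]; last by lra.
        by left; apply: ln_increasing => //; apply: exp_pos.
      have : INR (k n) * - x n <= INR (k n) * ln y by apply: Rmult_le_compat_l; lra.
      have : 2 * INR (k n) * x n <= L n / x n * x n by apply: Rmult_le_compat_r; lra.
      by lra.
    rewrite /c0 (_ : - (2 * gamma) = INR n * - (2 * p)); last by rewrite pE; field; lra.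
    have -> : exp (INR n * - (2 * p)) = exp (- (2 * p)) ^ n.
      by rewrite -Rpower_pow ?/Rpower ?ln_exp //; apply: exp_pos.
    apply: pow_incr; split; first exact/Rlt_le/exp_pos.
    rewrite exp_Ropp -[X in _ <= X]Rinv_inv; apply: Rinv_le_contravar.
      by apply: Rinv_0_lt_compat; lra.
    apply: (Rle_trans _ (1 + 2 * p)); last by apply: exp_ineq1_le.
    apply: (Rmult_le_reg_r (1 - p)); first by lra.
    by rewrite Rinv_l; nra.
  (* From b <= 1 - r <= exp(- r). *)
  set r := c0 * _ in key; have br : b <= exp (- r) by have := exp_ineq1_le (- r); lra.
  apply: (Rle_trans _ (exp (- r) ^ m_of 1 beta n)); first by apply: pow_incr.
  rewrite -Rpower_pow; last exact: exp_pos.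
  rewrite /Rpower ln_exp -[X in _ <= X](exp_ln eps) //.
  suff H : INR (m_of 1 beta n) * - r <= ln eps.
    by case: H => [?|->]; [left; apply: exp_increasing|right].
  have [mb _] := m_of_bounds 1 beta0 n; rewrite Rpower_1 // in mb.
  have mb2 : beta / 2 * INR n <= INR (m_of 1 beta n).
    have : beta / 2 * (2 / beta) <= beta / 2 * INR n by apply: Rmult_le_compat_l; lra.
    have -> : beta / 2 * (2 / beta) = 1 by field; lra.
    by lra.
  have r0 : 0 < r by apply: Rmult_lt_0_compat => //; apply: Rpower_gt0.
  have := Rmult_le_compat_r _ _ _ (Rlt_le _ _ r0) mb2.
  have -> : beta / 2 * INR n * r = beta / 2 * c0 * Rpower (INR n) (/ 2).
    rewrite /r -{1}[INR n]Rpower_1 //.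
    have -> : Rpower (INR n) (/ 2) = Rpower (INR n) 1 * Rpower (INR n) (- / 2).
      by rewrite -Rpower_plus; congr Rpower; field.
    by ring.
  have bc0 : 0 < beta / 2 * c0 by apply: Rmult_lt_0_compat; lra.
  have := Rmult_le_compat_l _ _ _ (Rlt_le _ _ bc0) npow.
  have -> : beta / 2 * c0 * (- ln eps / (beta / 2 * c0)) = - ln eps by field; lra.
  by lra.
split.
  apply: (somewhere_dense_nbhd a0 gamma0 small) => t; apply: ev_leq_INR.
  apply: ev_imp (ev_and kb (evx (16 * INR t))) => n [[x32 [Lq k1]] [xt _]].
  by have := Lxx _ x32 Lq; lra.
exists (/ 4); split; first by lra.
apply: (degeneracy_nbhd a0 gamma0 small).
by apply: ev_imp kb => n [_ [_ [? _]]].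
Qed.

(** * Attribute-disjoint path families in dense minors *)

Local Open Scope nat_scope.

Lemma leq_card_bigcup (I T : finType) (P : pred I) (G : I -> {set T}) :
  #|\bigcup_(i | P i) G i| <= \sum_(i | P i) #|G i|.
Proof.
elim/big_ind2: _ => [|x1 x2 y1 y2 ? ?|//]; first by rewrite cards0.
by rewrite (leq_trans (leq_card_setU _ _)) // leq_add.
Qed.

(* A maximal subfamily of pairwise disjoint sets meets every member of the family. *)
Lemma disjoint_subfamily (I T : finType) (E : {set I}) (A : I -> {set T}) s D :
  {in E, forall e, A e != set0} -> {in E, forall e, #|A e| <= s} ->
  (forall a, #|[set e in E | a \in A e]| <= D) ->
  exists F : {set I}, [/\ F \subset E,
    {in F &, forall e f, e != f -> [disjoint A e & A f]} & #|E| <= #|F| * (s * D)].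
Proof.
move=> A0 As AD.
pose P (F : {set I}) := (F \subset E) &&
  [forall e in F, forall f in F, (e != f) ==> [disjoint A e & A f]].
have exP : exists F, P F.
  by exists set0; rewrite /P sub0set; apply/forall_inP => e; rewrite inE.
have [F /maxsetP[/andP[FE /forall_inP disjF] maxF]] := ex_maxset exP.
have disj : {in F &, forall e f, e != f -> [disjoint A e & A f]}.
  by move=> e f /disjF /forall_inP eF /eF /implyP.
exists F; split => //.
(* A member of [E] disjoint from all of [F] could be added to [F]. Counting the cover then costs [s]
   points per member of [F] and [D] sets per point. *)
have cov : E \subset \bigcup_(f in F) \bigcup_(a in A f) [set e in E | a \in A e].
  apply/subsetP => e eE.
  suff /exists_inP[f fF /pred0Pn[a /andP[ae af]]] : [exists f in F, ~~ [disjoint A e & A f]].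
    by apply/bigcupP; exists f => //; apply/bigcupP; exists a => //; rewrite inE eE.
  case: (boolP (e \in F)) => [eF|eF].
    by apply/exists_inP; exists e => //; rewrite -setI_eq0 setIid A0.
  apply: contraT; rewrite negb_exists => /forallP eD.
  have eFD f : f \in F -> [disjoint A e & A f] by move=> fF; have := eD f; rewrite fF negbK.
  have := maxF (e |: F); rewrite subsetUr => maxe.
  suff Pe : P (e |: F) by move: eF; rewrite -(maxe Pe isT) setU11.
  rewrite /P subUset sub1set eE FE; apply/forall_inP => f; rewrite !inE => fe.
  apply/forall_inP => g; rewrite !inE => ge; apply/implyP => fg.
  case/predU1P: fe fg => [->|fF]; case/predU1P: ge => [->|gF] fg.
  - by rewrite eqxx in fg.
  - exact: eFD.
  - by rewrite disjoint_sym eFD.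
  - exact: disj.
apply: leq_trans (subset_leq_card cov) _.
apply: leq_trans (leq_card_bigcup _ _) _.
rewrite -sum_nat_const; apply: leq_sum => f fF.
apply: leq_trans (leq_card_bigcup _ _) _.
apply: (@leq_trans (\sum_(a in A f) D)); first by apply: leq_sum.
by rewrite sum_nat_const leq_mul2r As ?orbT // (subsetP FE).
Qed.

Lemma pigeonhole (I : finType) (F : {set I}) k (l : I -> 'I_k.+1) q :
  q * k.+1 <= #|F| -> exists i, q <= #|[set f in F | l f == i]|.
Proof.
move=> qF; apply/existsP; apply: contraLR qF; rewrite negb_exists -ltnNge => /forallP lt.
rewrite -sum1_card (partition_big l xpredT) //=.
case: q lt => [|q] lt; first by have := lt ord0.
apply: (@leq_trans (\sum_(i < k.+1) q).+1).
  rewrite ltnS; apply: leq_sum => i _; rewrite sum1_card.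
  by have := lt i; rewrite -ltnNge ltnS; apply: leq_trans; apply: subset_leq_card;
    apply/subsetP => f; rewrite !inE.
by rewrite sum_nat_const card_ord mulnC ltn_pmul2r.
Qed.

(** * Walks of the bipartite graph and their shortening *)

Section Walks.
Variables (n m : nat) (B : bip n m).
Implicit Types (u v : 'I_n) (a : 'I_m) (w : seq ('I_m * 'I_n)).

(* [w] lists the pairs (attribute, next node) along a walk of [B] starting at [u]. *)
Fixpoint bwalk u w : bool :=
  if w is (a, v) :: w' then [&& B (u, a), B (v, a), u != v & bwalk v w'] else true.

Lemma bwalk_cat u w1 w2 :
  bwalk u (w1 ++ w2) = bwalk u w1 && bwalk (last u (unzip2 w1)) w2.
Proof. by elim: w1 u => [|[a v] w1 IH] u //=; rewrite IH !andbA. Qed.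

Lemma bwalk_nth u w z0 i : bwalk u w -> i < size w ->
  let z := nth z0 w i in let x := nth u (u :: unzip2 w) i in
  [/\ B (x, z.1), B (z.2, z.1) & x != z.2].
Proof.
elim: w u i => [|[a v] w IH] u i //= /and4P[ua va uv wv]; case: i => [|i] //= iw.
have := IH v i wv iw; rewrite /= (set_nth_default u) //.
by rewrite /= size_map ltnS ltnW.
Qed.

Lemma bwalk_mem u w a : bwalk u w -> a \in unzip1 w ->
  exists x y, [/\ x \in u :: unzip2 w, y \in u :: unzip2 w, x != y,
                  x \in nbhd B a & y \in nbhd B a].
Proof.
elim: w u => [|[b v] w IH] u //= /and4P[ub vb uv wv].
rewrite inE => /predU1P[->|aw].
  by exists u, v; rewrite !inE !eqxx orbT ub vb.
have [x [y [xw yw xy xa ya]]] := IH v wv aw.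
by exists x, y; rewrite [x \in u :: _]inE xw [y \in u :: _]inE yw !orbT.
Qed.

(* A repeated attribute allows a shortcut. *)
Lemma shorten_path u s : path (rig_adj B) u s -> uniq (u :: s) ->
  exists w, [/\ bwalk u w, last u (unzip2 w) = last u s, uniq (unzip1 w),
                size w <= size s & {subset unzip2 w <= s}].
Proof.
elim: s u => [|v s IH] u; first by exists [::].
rewrite cons_uniq => /= /andP[/andP[uv /existsP[a /andP[ua va]]] vs] /andP[us vsu].
have [w [wv lw uw sw ws]] := IH v vs vsu.
case: (boolP (a \in unzip1 w)) => aw; last first.
  exists ((a, v) :: w); split; rewrite //= ?ua ?va ?uv ?aw //.
  by move=> x; rewrite !inE => /predU1P[->|/ws ->]; rewrite ?eqxx ?orbT.
(* The attribute [a] of the first step recurs later and leads to [y]; both [u] and [y] have [a], so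
   one step goes from [u] straight to [y]. *)
case/mapP: aw => -[b y] yw /= ab; rewrite -{}ab {b} in yw.
case/splitPr: yw wv lw uw sw ws => w1 w2.
rewrite bwalk_cat /= => /and5P[_ _ ya _ yw2].
rewrite /unzip2 map_cat last_cat /= => lw; rewrite /unzip1 map_cat cat_uniq /=.
move=> /and3P[_ _ /andP[aw2 uw2]] sw ws.
have ys : y \in s by apply: ws; rewrite mem_cat inE eqxx orbT.
exists ((a, y) :: w2); split; rewrite //= ?ua ?ya ?aw2 ?uw2 ?yw2 //.
- by rewrite andbT; apply: contraNneq us => ->; rewrite inE ys orbT.
- by rewrite ltnS (leq_trans _ sw) // size_cat /= addnS leqW // leq_addl.
- by move=> x xw; rewrite inE ws ?orbT // mem_cat xw orbT.
Qed.

End Walks.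

(** A candidate walk of l + 1 steps: start node, [l] steps to inner nodes, and the last step kept
    apart so that its end can be constrained to a nail. The last step also serves as default for
    [nth]. *)
Definition conf n m l := ('I_n * (l.-tuple ('I_m * 'I_n) * ('I_m * 'I_n)))%type.

(** * Families of walks with distinct bipartite edges, and their number *)

Section Families.
Variables (n m l q : nat).
Implicit Types (c : conf n m l) (t : {ffun 'I_q -> conf n m l}).

Definition conf_walk c : seq ('I_m * 'I_n) := rcons c.2.1 c.2.2.

Definition conf_ends (S : {set 'I_n}) : {set conf n m l} :=
  setX S (setX setT (setX setT S)).

(** Each step uses two edges at its attribute; the Boolean selects the one to the next node ([true])
    or to the previous node ([false]). *)
Definition conf_edge c (ib : 'I_l.+1 * bool) : 'I_n * 'I_m :=
  let z := nth c.2.2 (conf_walk c) ib.1 in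
  (if ib.2 then z.2 else nth c.1 (c.1 :: unzip2 (conf_walk c)) ib.1, z.1).

Definition fam_edge t (z : 'I_q * ('I_l.+1 * bool)) : 'I_n * 'I_m :=
  conf_edge (t z.1) z.2.

(** Injectivity over all 2 q (l + 1) edges makes the presence probability an exact power of [p]. *)
Definition good_fam (S : {set 'I_n}) t : bool :=
  (t \in ffun_on (mem (conf_ends S))) && injectiveb (fam_edge t).

Definition present (B : bip n m) t : bool := [forall z, B (fam_edge t z)].

Lemma good_fam_inj S t : good_fam S t -> injective t.
Proof.
move=> /andP[_ /injectiveP inj_t] i j tij.
have := inj_t (i, (ord0, true)) (j, (ord0, true)).
by rewrite /fam_edge /= tij => /(_ erefl) [].
Qed.

(* All reorderings of a good family are good, which allows the division in [fams]. *)
Lemma card_good_fam_present S B t : good_fam S t -> present B t ->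
  q`! <= #|[set t | good_fam S t && present B t]|.
Proof.
move=> gt /forallP pt; have t_inj := good_fam_inj gt.
case/andP: gt => /ffun_onP tS /injectiveP et_inj.
have -> : q`! = #|[set f : {ffun 'I_q -> 'I_q} | injectiveb f]|.
  by rewrite card_inj_ffuns card_ord ffactnn.
pose re (f : {ffun 'I_q -> 'I_q}) := [ffun j => t (f j)].
rewrite -(@card_imset _ _ re); last first.
  move=> f g /ffunP fg; apply/ffunP => j; apply: t_inj.
  by have := fg j; rewrite !ffunE.
apply: subset_leq_card; apply/subsetP => _ /imsetP[f + ->].
rewrite !inE => /injectiveP f_inj; rewrite /good_fam -andbA; apply/and3P; split.
- by apply/ffun_onP => j; rewrite ffunE.
- apply/injectiveP => -[i z] [j z']; rewrite /fam_edge /= !ffunE => e.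
  by have := et_inj (f i, z) (f j, z'); rewrite /fam_edge /= => /(_ e) [/f_inj -> ->].
- by apply/forallP => -[i z]; have := pt (f i, z); rewrite /fam_edge /= ffunE.
Qed.

Lemma card_conf_ends S : #|conf_ends S| = #|S| * ((m * n) ^ l * (m * #|S|)).
Proof. by rewrite !cardsX !cardsT card_tuple !card_prod !card_ord. Qed.

Lemma card_good_fam S : #|good_fam S| <= (#|S| * ((m * n) ^ l * (m * #|S|))) ^ q.
Proof.
rewrite -card_conf_ends -[q in _ ^ q]card_ord -card_ffun_on.
by apply: subset_leq_card; apply/subsetP => t /andP[].
Qed.

End Families.

Lemma conf_of_walk n m (B : bip n m) u v l w :
  bwalk B u w -> last u (unzip2 w) = v -> size w = l.+1 ->
  exists c : conf n m l, [/\ c.1 = u, conf_walk c = w & c.2.2.2 = v].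
Proof.
case/lastP: w => [//|w z] _; rewrite /unzip2 map_rcons last_rcons size_rcons.
move=> zv [sw]; have sw' : size w == l by apply/eqP.
by exists (u, (Tuple sw', z)).
Qed.

(** * From a dense shallow minor to a good family present in [B] *)

Section DenseMinor.
Variables (n m : nat) (B : bip n m) (d k C h : nat) (eH : rel 'I_h).
Hypothesis nbhd_le : forall a, #|nbhd B a| <= d.
Hypothesis minor : shallow_top_minor eH (rig_adj B) k.

(** The factor (k + 1) d^2 is lost when passing to attribute-disjoint walks, each with at most k + 1
    attributes that serve at most d^2 walks each; the other factor k + 1 is lost when fixing the
    length. *)
Lemma dense_minor_family : 0 < d ->
  (k.+1 * (d * d)) * (C * h * k.+1) <= nedges eH ->
  exists S : {set 'I_n}, #|S| = h /\
  exists (l : 'I_k.+1) (t : {ffun 'I_(C * h) -> conf n m l}),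
    good_fam S t /\ present B t.
Proof.
move=> d0; rewrite /nedges; set E := [set ij | _] => dense.
have [nail [P [nail_inj [Ppath Pdisj]]]] := minor.
have EP ij : ij \in E -> (ij.1 < ij.2) * eH ij.1 ij.2.
  by rewrite inE => /andP[].
have exW (ij : 'I_h * 'I_h) : exists w, ij \in E ->
    [/\ bwalk B (nail ij.1) w, last (nail ij.1) (unzip2 w) = nail ij.2,
        uniq (unzip1 w), 0 < size w <= k.+1 &
        {subset unzip2 w <= rcons (P ij.1 ij.2) (nail ij.2)}].
  case: (boolP (ij \in E)) => ijE; last by exists [::].
  case: ij ijE => i j /EP[/= ij eij]; have [pij sP uP nP] := Ppath i j ij eij.
  have uu : uniq (nail i :: rcons (P i j) (nail j)).
    rewrite /= rcons_uniq mem_rcons inE uP andbT negb_or -andbA; apply/and3P; split.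
    - by apply/negP => /eqP/nail_inj ij'; rewrite ij' ltnn in ij.
    - by apply/negP => /nP/(_ i); rewrite eqxx.
    - by apply/negP => /nP/(_ j); rewrite eqxx.
  have [w [wn lw uw sw ws]] := shorten_path pij uu.
  rewrite last_rcons in lw; rewrite size_rcons in sw; exists w => _; split => //.
  rewrite (leq_trans sw) // andbT lt0n size_eq0; apply/eqP => w0.
  by move: lw ij; rewrite w0 /= => /nail_inj ->; rewrite ltnn.
have [W WP] := fin_all_exists exW.
pose A ij : {set 'I_m} := [set a in unzip1 (W ij)].
have cardA ij : ij \in E -> #|A ij| = size (W ij).
  by move=> /WP[_ _ uw _ _]; rewrite cardsE (card_uniqP uw) size_map.
have [||a|F [FE disjF cardF]] := @disjoint_subfamily _ _ E A k.+1 (d * d).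
- by move=> e eE; have [_ _ _ /andP[s0 _] _] := WP e eE; rewrite -card_gt0 cardA.
- by move=> e eE; have [_ _ _ /andP[_ s1] _] := WP e eE; rewrite cardA.
- (* Two consecutive nodes of the walk, both in [nbhd B a], determine the edge of [H]. *)
  have exxy (e : 'I_h * 'I_h) : exists xy : 'I_n * 'I_n, e \in E -> a \in A e ->
      [/\ xy.1 \in nail e.1 :: rcons (P e.1 e.2) (nail e.2),
          xy.2 \in nail e.1 :: rcons (P e.1 e.2) (nail e.2), xy.1 != xy.2,
          xy.1 \in nbhd B a & xy.2 \in nbhd B a].
    case: (boolP ((e \in E) && (a \in A e))) => [/andP[eE aE]|ne]; last first.
      by exists (nail e.1, nail e.1) => eE aE; rewrite eE aE in ne.
    have [we _ _ _ ws] := WP e eE; rewrite inE in aE.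
    have [x [y [xw yw xy xa ya]]] := bwalk_mem we aE.
    exists (x, y) => _ _; split => //.
      by move: xw; rewrite !inE => /predU1P[->|/ws ->]; rewrite ?eqxx ?orbT.
    by move: yw; rewrite !inE => /predU1P[->|/ws ->]; rewrite ?eqxx ?orbT.
  have [f fP] := fin_all_exists exxy.
  apply: (@leq_trans #|setX (nbhd B a) (nbhd B a)|); last first.
    by rewrite cardsX leq_mul.
  rewrite -(@card_in_imset _ _ f); last first.
    move=> e e' /setIdP[eE aE] /setIdP[eE' aE'] fe.
    have [xw yw xy _ _] := fP e eE aE; have [] := fP e' eE' aE'; rewrite -fe.
    move: xw yw xy; case: (f e) => x y /= {fe}.
    have /EP[lt eh] := eE; have /EP[lt' eh'] := eE'.
    have [_ _ _ nP] := Ppath _ _ lt eh; have [_ _ _ nP'] := Ppath _ _ lt' eh'.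
    case: e e' eE aE eE' aE' lt eh lt' eh' nP nP' => i j [i' j'] /= _ _ _ _ lt eh lt' eh' nP nP'.
    (* An inner node lies on one path only. If neither [x] nor [y] is inner, they are the two nails
       of both edges, and i < j fixes their order. *)
    have same z : z \in P i j -> z \in nail i' :: rcons (P i' j') (nail j') -> (i, j) = (i', j').
      move=> zP; rewrite inE mem_rcons inE !(negbTE (nP z zP _)) /= => zP'.
      apply/eqP/negPn/negP => /eqP ne.
      by have := Pdisj _ _ _ _ lt eh lt' eh' ne z zP; rewrite zP'.
    have ends z : z \notin P i j -> z \in nail i :: rcons (P i j) (nail j) ->
        z = nail i \/ z = nail j.
      move=> zP; rewrite inE mem_rcons inE (negbTE zP) orbF.
      by case/orP => /eqP ->; [left|right].
    have nailP' r : nail r \in nail i' :: rcons (P i' j') (nail j') -> r = i' \/ r = j'.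
      rewrite inE mem_rcons inE => /or3P[/eqP/nail_inj ->|/eqP/nail_inj ->|]; [by left|by right|].
      by move/nP'/(_ r); rewrite eqxx.
    move=> xw yw xy xw' yw' _ _ _.
    case: (boolP (x \in P i j)) => [xP|/ends /(_ xw) xe]; first exact: same xP xw'.
    case: (boolP (y \in P i j)) => [yP|/ends /(_ yw) ye]; first exact: same yP yw'.
    have [wi wj] : (i = i' \/ i = j') /\ (j = i' \/ j = j').
      by case: xe xw' xy => -> /nailP' xi; case: ye yw' => -> /nailP' yi; rewrite ?eqxx.
    case: wi wj => -> [] -> // in lt lt' *; try by rewrite ltnn in lt.
    by have := ltn_trans lt lt'; rewrite ltnn.
  by apply: subset_leq_card; apply/subsetP => _ /imsetP[e /setIdP[eE aE] ->];
    have [_ _ _ xa ya] := fP e eE aE; rewrite inE xa ya.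
have FE' e : e \in F -> e \in E by apply: (subsetP FE).
have qF : C * h * k.+1 <= #|F|.
  have := leq_trans dense cardF; rewrite mulnC leq_mul2r => /orP[|//].
  by rewrite muln_eq0 /= muln_eq0 eqn0Ngt d0.
(* Sizes range from 1 to k + 1, so the predecessor is within the range of [inord]. *)
have [l ql] := pigeonhole (fun e : 'I_h * 'I_h => inord (size (W e)).-1 : 'I_k.+1) qF.
set Fl := [set f in F | _] in ql.
pose e_ (j : 'I_(C * h)) : 'I_h * 'I_h := enum_val (widen_ord ql j).
have e_inj : injective e_.
  by move=> i j /enum_val_inj /(congr1 val) /= ij; apply: val_inj.
have eFl j : (e_ j \in F) /\ size (W (e_ j)) = l.+1.
  have := enum_valP (widen_ord ql j); rewrite inE -/(e_ j) => /andP[eF /eqP <-].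
  have [_ _ _ /andP[s0 s1] _] := WP _ (FE' _ eF).
  by split=> //; rewrite inordK ?prednK // ltnS.
exists [set nail i | i : 'I_h]; split.
  by rewrite card_imset // card_ord.
exists l.
have exc j : exists c : conf n m l, [/\ c.1 = nail (e_ j).1, conf_walk c = W (e_ j) & c.2.2.2 = nail (e_ j).2].
  have [eF sW] := eFl j; have [we lw _ _ _] := WP _ (FE' _ eF).
  exact: conf_of_walk we lw sW.
have [c cP] := fin_all_exists exc.
have cedge j ib : B (conf_edge (c j) ib).
  have [c1 c2 _] := cP j; have [eF sW] := eFl j; have [we _ _ _ _] := WP _ (FE' _ eF).
  have lt : ib.1 < size (W (e_ j)) by rewrite sW.
  have := bwalk_nth (c j).2.2 we lt; rewrite /conf_edge c1 c2 /= => -[b1 b2 _].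
  by case: ib.2.
exists [ffun j => c j]; split; last first.
  by apply/forallP => -[j ib]; rewrite /fam_edge /= ffunE.
apply/andP; split.
  apply/ffun_onP => j; rewrite ffunE; have [c1 _ c3] := cP j.
  by rewrite !inE /= c1 c3 !imset_f.
apply/injectiveP => -[j [i b]] [j' [i' b']]; rewrite /fam_edge /= !ffunE.
have [c1 c2 _] := cP j; have [eF sW] := eFl j; have [we _ uw _ _] := WP _ (FE' _ eF).
have [c1' c2' _] := cP j'; have [eF' sW'] := eFl j'; have [_ _ _ _ _] := WP _ (FE' _ eF').
have lt : i < size (W (e_ j)) by rewrite sW.
have lt' : i' < size (W (e_ j')) by rewrite sW'.
rewrite /conf_edge c1 c2 c1' c2' /= => -[e1 e2].
have ein z : nth z (W (e_ j)) i \in W (e_ j) by apply: mem_nth.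
have ein' z : nth z (W (e_ j')) i' \in W (e_ j') by apply: mem_nth.
(* Equal edges share an attribute. Disjointness between walks gives j = j', distinct attributes
   along a walk give i = i', and distinct consecutive nodes give b = b'. *)
have jj : j = j'.
  apply: e_inj; apply/eqP/negPn/negP => ne.
  have := disjF _ _ eF eF' ne; rewrite disjoints_subset => /subsetP.
  move=> /(_ (nth (c j).2.2 (W (e_ j)) i).1); rewrite !inE map_f ?ein // => /(_ isT).
  by rewrite e2 map_f ?ein'.
subst j'.
have ii : i = i'.
  apply: val_inj; apply/eqP; have := nth_uniq (c j).2.2.1 _ _ uw.
  move=> /(_ i i'); rewrite !size_map => /(_ lt lt') <-.
  by rewrite !(nth_map (c j).2.2) // e2.
subst i'.
have [_ _ ne] := bwalk_nth (c j).2.2 we lt.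
case: b b' e1 => [] [] //= e1; first by rewrite -e1 eqxx in ne.
by rewrite e1 eqxx in ne.
Qed.

End DenseMinor.

(** * First moment bounds for [alpha > 1] *)

Lemma bigmin_leq (I : eqType) (r : seq I) (P : pred I) (F : I -> nat) x j :
  j \in r -> P j -> \big[minn/x]_(i <- r | P i) F i <= F j.
Proof.
elim: r => [//|i r IH]; rewrite inE big_cons => /predU1P[<- ->|jr Pj].
  exact: geq_minl.
by case: ifP => _; rewrite ?geq_min ?IH ?orbT.
Qed.

(** Handshake count in the subgraph induced by [S]: [nedges] sees only pairs i < j, and swapping
    them supplies the other half of the degree sum. *)
Lemma mindeg_leq_nedges (T : finType) (e : rel T) (S : {set T}) :
  symmetric e -> irreflexive e ->
  mindeg e S * #|S| <=
  (nedges (fun i j : 'I_#|S| => e (enum_val i) (enum_val j))).*2.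
Proof.
move=> e_sym e_irr; set eH := fun _ _ => _.
pose D := [set ij : 'I_#|S| * 'I_#|S| | eH ij.1 ij.2].
rewrite /nedges; set E := [set ij | _].
pose sw (ij : 'I_#|S| * 'I_#|S|) := (ij.2, ij.1).
have DE : D \subset E :|: sw @: E.
  apply/subsetP => -[i j]; rewrite !inE /= => eij; rewrite eij andbT.
  case: ltngtP => //= [ji|/val_inj ij]; last by rewrite ij /eH e_irr in eij.
  by apply/imsetP; exists (j, i); rewrite // inE /= ji /eH e_sym.
have cD : #|D| <= #|E|.*2.
  rewrite -addnn (leq_trans (subset_leq_card DE)) //.
  by rewrite (leq_trans (leq_card_setU _ _)) // leq_add2l leq_imset_card.
apply: leq_trans cD; rewrite /D -sum1dep_card.
rewrite -(pair_big_dep xpredT (fun i j => eH i j) (fun _ _ => 1)) /=.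
rewrite mulnC -[X in X * _]card_ord -sum_nat_const; apply: leq_sum => i _.
rewrite sum1dep_card.
apply: (@leq_trans #|[set u in S | e (enum_val i) u]|).
  by apply: bigmin_leq; [rewrite mem_index_enum|apply: enum_valP].
rewrite -(card_imset _ (@enum_val_inj _ (mem S))).
apply: subset_leq_card; apply/subsetP => u /setIdP[uS eu].
by apply/imsetP; exists (enum_rank_in uS u); rewrite ?inE /eH enum_rankK_in.
Qed.

Local Open Scope R_scope.

(** Every induced subgraph is a 0-shallow minor, and its minimum degree is at most its average
    degree, twice its density. *)
Lemma degeneracy_le_top_grad (T : finType) (e : rel T) c :
  symmetric e -> irreflexive e -> 0 <= c -> top_grad_le e 0 c ->
  INR (degeneracy e) <= 2 * c.
Proof.
move=> e_sym e_irr c0 grad; rewrite /degeneracy.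
elim/big_ind: _ => [|x y xc yc|S S0]; first by rewrite /=; lra.
  by rewrite /maxn; case: ifP.
have h0 : (0 < #|S|)%N by rewrite card_gt0.
set eH := fun i j : 'I_#|S| => e (enum_val i) (enum_val j).
have minor : shallow_top_minor eH e 0.
  exists enum_val, (fun _ _ => [::]); split; first exact: enum_val_inj.
  by split => // i j _ ij; split; rewrite //= andbT.
have H0 : 0 < INR #|S| by apply: lt_0_INR; apply/ltP.
have := grad _ eH h0 minor => den.
have := Rmult_le_compat_r _ _ _ (Rlt_le _ _ H0) den.
have -> : INR (nedges eH) / INR #|S| * INR #|S| = INR (nedges eH) by field; lra.
have := le_INR _ _ (elimT leP (mindeg_leq_nedges S e_sym e_irr)).
rewrite -/eH -addnn -plusE plus_INR -multE mult_INR => h1 h2.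
apply: (Rmult_le_reg_r (INR #|S|)) => //; lra.
Qed.

Lemma rig_adj_sym n m (B : bip n m) : symmetric (rig_adj B).
Proof.
move=> u v; rewrite /rig_adj eq_sym; congr (_ && _).
by apply: eq_existsb => a; rewrite andbC.
Qed.

Lemma rig_adj_irr n m (B : bip n m) : irreflexive (rig_adj B).
Proof. by move=> u; rewrite /rig_adj eqxx. Qed.

Lemma Ex_present n m l q p (S : {set 'I_n}) (t : {ffun 'I_q -> conf n m l}) :
  good_fam S t -> Ex p (fun B => indic (present B t)) = p ^ (q * (l.+1 * 2)).
Proof.
case/andP => _ /injectiveP inj.
have -> : (q * (l.+1 * 2))%N = #|fam_edge t @: setT|.
  by rewrite card_imset // cardsT !card_prod !card_ord card_bool.
rewrite -Ex_subset; apply: eq_bigr => B _; congr (_ * indic _).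
apply/forallP/forall_inP => [pB _ /imsetP[z _ ->] //|ZB z].
by apply: ZB; rewrite imset_f.
Qed.

Lemma pow_le_1_antitone x i j : 0 <= x <= 1 -> (i <= j)%N -> x ^ j <= x ^ i.
Proof.
move=> x01 ij; rewrite -(subnK ij) -plusE pow_add -[X in _ <= X]Rmult_1_l.
apply: Rmult_le_compat_r; first by apply: pow_le; lra.
by rewrite -[X in _ <= X](pow1 (j - i)); apply: pow_incr; lra.
Qed.

(* The expected number of families supported by nail sets of size [h];
   both factorials are estimated by [a ^ a <= 3 ^ a * a`!]. *)
Lemma family_term_bound n h C K : (0 < h <= n)%N -> (2 <= C)%N ->
  0 <= K -> 36 * K <= INR C ->
  INR 'C(n, h) * (/ INR (C * h)`! * (INR h * INR h / INR n * K) ^ (C * h)) <=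
  / INR n * (/ 2) ^ h.
Proof.
move=> /andP[h0 hn] C2 K0 KC.
have H0 : 0 < INR h by apply: lt_0_INR; apply/ltP.
have N0 : 0 < INR n by apply: lt_0_INR; apply/ltP; apply: leq_trans hn.
have HN : INR h <= INR n by apply/le_INR/leP.
have C0 : 0 < INR C by apply: lt_0_INR; apply/ltP; apply: leq_trans C2.
have f0 j : 0 < INR j`! by apply: lt_0_INR; apply/ltP; rewrite fact_gt0.
set y := INR h / INR n.
have y0 : 0 < y by apply: Rdiv_lt_0_compat.
have yN : y * INR n = INR h by rewrite /y; field; lra.
have y1 : y <= 1 by apply: (Rmult_le_reg_r (INR n)) => //; lra.
have b1 : INR 'C(n, h) <= (3 / y) ^ h.
  apply: (Rmult_le_reg_r (INR h`!)) => //.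
  apply: (Rle_trans _ _ _ (bin_le_pow n h)).
  have -> : INR n = INR h / y by rewrite -yN; field; lra.
  rewrite /Rdiv !Rpow_mult_distr.
  have := pow_le_fact h => pf.
  have iy : 0 <= (/ y) ^ h by apply: pow_le; left; apply: Rinv_0_lt_compat.
  by have := Rmult_le_compat_r _ _ _ iy pf; lra.
have qE : INR (C * h)%N = INR C * INR h by rewrite -multE mult_INR.
have q0 : 0 < INR (C * h)%N by rewrite qE; apply: Rmult_lt_0_compat.
(* With q = C h, the weak Stirling bound gives q! >= (q / 3)^q, and 36 K <= C gives h y K <= (q / 3)
   (y / 12). *)
have b2 : / INR (C * h)`! * (INR h * INR h / INR n * K) ^ (C * h) <= (y / 12) ^ (C * h).
  apply: (Rmult_le_reg_l (INR (C * h)`!)) => //.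
  rewrite -Rmult_assoc Rinv_r ?Rmult_1_l; last by have := f0 (C * h)%N; lra.
  apply: (Rle_trans _ ((INR (C * h) / 3) ^ (C * h) * (y / 12) ^ (C * h))).
    rewrite -Rpow_mult_distr; apply: pow_incr; split.
      apply: Rmult_le_pos => //; apply: Rmult_le_pos; first by nra.
      by left; apply: Rinv_0_lt_compat.
    rewrite qE.
    have -> : INR h * INR h / INR n * K = INR h * y * K by rewrite /y; field; lra.
    have -> : INR C * INR h / 3 * (y / 12) = INR h * y * (INR C / 36) by field.
    apply: Rmult_le_compat_l; last by lra.
    by apply: Rmult_le_pos; lra.
  apply: Rmult_le_compat_r; first by apply: pow_le; lra.
  rewrite /Rdiv Rpow_mult_distr pow_inv.
  have t0 : 0 < 3 ^ (C * h) by apply: pow_lt; lra.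
  apply: (Rmult_le_reg_r (3 ^ (C * h))) => //.
  rewrite Rmult_assoc Rinv_l ?Rmult_1_r; last by lra.
  by have := pow_le_fact (C * h); lra.
have b3 : (y / 12) ^ (C * h) <= ((y / 12) ^ 2) ^ h.
  rewrite -pow_mult; apply: pow_le_1_antitone; first by lra.
  by rewrite multE leq_mul2r C2 orbT.
apply: (Rle_trans _ ((3 / y) ^ h * ((y / 12) ^ 2) ^ h)).
  apply: Rmult_le_compat; [exact: pos_INR| |exact: b1|by apply: Rle_trans b2 b3].
  apply: Rmult_le_pos; first by left; apply: Rinv_0_lt_compat.
  apply: pow_le; apply: Rmult_le_pos => //; apply: Rmult_le_pos; first by nra.
  by left; apply: Rinv_0_lt_compat.
rewrite -Rpow_mult_distr.
apply: (Rle_trans _ ((y * / 4) ^ h)).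
  apply: pow_incr; have -> : 3 / y * (y / 12) ^ 2 = y / 48 by field; lra.
  by lra.
rewrite Rpow_mult_distr.
(* One factor y = h / n is kept: it provides 1 / n, while its h is absorbed by h 2^(-h) <= 1. *)
apply: (Rle_trans _ (y * (/ 4) ^ h)).
  apply: Rmult_le_compat_r; first by apply: pow_le; lra.
  by rewrite -[X in _ <= X]pow_1; apply: pow_le_1_antitone => //; lra.
have -> : (/ 4) ^ h = (/ 2) ^ h * (/ 2) ^ h.
  by rewrite -Rpow_mult_distr; congr pow; lra.
have h2 : INR h * (/ 2) ^ h <= 1.
  rewrite pow_inv; have t0 : 0 < 2 ^ h by apply: pow_lt; lra.
  apply: (Rmult_le_reg_r (2 ^ h)) => //.
  rewrite Rmult_assoc Rinv_l ?Rmult_1_r ?Rmult_1_l; last by lra.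
  have -> : 2 ^ h = INR (2 ^ h)%N by rewrite INR_expn.
  by apply/le_INR/leP/ltnW/ltn_expl.
have -> : y * ((/ 2) ^ h * (/ 2) ^ h) = / INR n * (/ 2) ^ h * (INR h * (/ 2) ^ h).
  by rewrite /y /Rdiv; ring.
rewrite -[X in _ <= X]Rmult_1_r; apply: Rmult_le_compat_l => //.
apply: Rmult_le_pos; first by left; apply: Rinv_0_lt_compat.
by apply: pow_le; lra.
Qed.

Lemma sum_half n : \big[Rplus/0]_(h < n) (/ 2) ^ h <= 2.
Proof.
suff : \big[Rplus/0]_(h < n) (/ 2) ^ h = 2 - 2 * (/ 2) ^ n.
  have : 0 < (/ 2) ^ n by apply: pow_lt; lra.
  by move=> ? ->; lra.
elim: n => [|n IH]; first by rewrite big_ord0 /=; lra.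
by rewrite big_ord_recr /= IH; field.
Qed.

(** * Random sums that dominate the failure of the density bound *)

Section FirstMoment.
Variables (n m d k C : nat) (p : R).

(** Counts the (d + 1)-subsets of the neighbourhoods, hence is at least 1 once some attribute has
    more than [d] nodes. *)
Definition big_nbhds (B : bip n m) : R :=
  \big[Rplus/0]_(a : 'I_m) \big[Rplus/0]_(S : {set 'I_n} | #|S| == d.+1)
    indic [forall x in setX S [set a], B x].

(** The number of present good families up to reordering; the division by q! is what makes the later
    sum over [h] converge. *)
Definition fams (h l : nat) (S : {set 'I_n}) (B : bip n m) : R :=
  / INR (C * h)`! *
  \big[Rplus/0]_(t : {ffun 'I_(C * h) -> conf n m l} | good_fam S t) indic (present B t).

Definition all_fams (B : bip n m) : R :=
  \big[Rplus/0]_(h < n.+1 | (0 < h)%N) \big[Rplus/0]_(l < k.+1)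
    \big[Rplus/0]_(S : {set 'I_n} | #|S| == h) fams h l S B.

Lemma fams_ge0 h l S B : 0 <= fams h l S B.
Proof.
apply: Rmult_le_pos; first by left; apply/Rinv_0_lt_compat/lt_0_INR/ltP/fact_gt0.
by apply: Rsum_ge0 => t _; apply: indic_ge0.
Qed.

Lemma all_fams_ge0 B : 0 <= all_fams B.
Proof. by do 3![apply: Rsum_ge0 => ? _]; apply: fams_ge0. Qed.

Lemma big_nbhds_ge0 B : 0 <= big_nbhds B.
Proof. by do 2![apply: Rsum_ge0 => ? _]; apply: indic_ge0. Qed.

Lemma big_nbhds_ge1 B a : (d < #|nbhd B a|)%N -> 1 <= big_nbhds B.
Proof.
move=> da; have := cards_draws (nbhd B a) d.+1.
have : (0 < 'C(#|nbhd B a|, d.+1))%N by rewrite bin_gt0.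
move=> + E; rewrite -E card_gt0 => /set0Pn[S]; rewrite inE => /andP[SN Sd].
apply: (Rle_trans _ (indic [forall x in setX S [set a], B x])).
  rewrite (_ : [forall x in _, _]) /=; first by lra.
  apply/forall_inP => -[v b]; rewrite in_setX => /andP[vS]; rewrite inE => /eqP ->.
  by have := subsetP SN v vS; rewrite inE.
apply: (Rle_trans _ (\big[Rplus/0]_(S : {set 'I_n} | #|S| == d.+1)
    indic [forall x in setX S [set a], B x])).
  by apply: (Rsum_term_le (F := fun S => indic [forall x in setX S [set a], B x])) => // ? _;
     apply: indic_ge0.
apply: (Rsum_term_le (F := fun a => \big[Rplus/0]_(S : {set 'I_n} | #|S| == d.+1)
    indic [forall x in setX S [set a], B x])) => // ? _.
by apply: Rsum_ge0 => ? _; apply: indic_ge0.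
Qed.

Lemma fams_ge1 h l (S : {set 'I_n}) B (t : {ffun 'I_(C * h) -> conf n m l}) :
  good_fam S t -> present B t -> 1 <= fams h l S B.
Proof.
move=> gt pt; have /leP/le_INR := card_good_fam_present gt pt.
have f0 : 0 < INR (C * h)`! by apply/lt_0_INR/ltP/fact_gt0.
rewrite /fams; set s := \big[Rplus/0]_(_ | _) _ => le.
have sE : s = INR #|[set t : {ffun 'I_(C * h) -> conf n m l} | good_fam S t && present B t]|.
  rewrite /s (bigID (fun t => present B t)) /= [X in _ + X]big1; last first.
    by move=> t' /andP[_ /negbTE ->].
  rewrite (eq_bigr (fun=> 1)); last by move=> t' /andP[_ ->].
  rewrite Rsum_const Rplus_0_r Rmult_1_r; congr INR.
  by apply: eq_card => t'; rewrite !inE.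
rewrite -(Rinv_l (INR (C * h)`!)); last by lra.
apply: Rmult_le_compat_l; first by left; apply: Rinv_0_lt_compat.
by rewrite sE.
Qed.

Lemma all_fams_ge1 h (l : 'I_k.+1) (S : {set 'I_n}) B (t : {ffun 'I_(C * h) -> conf n m l}) :
  (0 < h <= n)%N -> #|S| = h -> good_fam S t -> present B t -> 1 <= all_fams B.
Proof.
move=> /andP[h0 hn] Sh gt pt; have hn' : (h < n.+1)%N by [].
apply: (Rle_trans _ _ _ (fams_ge1 gt pt)).
apply: (Rle_trans _ (\big[Rplus/0]_(S : {set 'I_n} | #|S| == h) fams h l S B)).
  apply: (Rsum_term_le (F := fun S => fams h l S B)); first by apply/eqP.
  by move=> ? _; apply: fams_ge0.
apply: (Rle_trans _ (\big[Rplus/0]_(l < k.+1)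
    \big[Rplus/0]_(S : {set 'I_n} | #|S| == h) fams h l S B)).
  apply: (Rsum_term_le (F := fun l : 'I_k.+1 =>
    \big[Rplus/0]_(S : {set 'I_n} | #|S| == h) fams h l S B)) => // ? _.
  by apply: Rsum_ge0 => ? _; apply: fams_ge0.
apply: (Rsum_term_le (i0 := Ordinal hn') (F := fun h : 'I_n.+1 => \big[Rplus/0]_(l < k.+1)
    \big[Rplus/0]_(S : {set 'I_n} | #|S| == h) fams h l S B)) => // ? _.
by do 2![apply: Rsum_ge0 => ? _]; apply: fams_ge0.
Qed.

(** The constant is the edge threshold of [dense_minor_family] divided by [h]. A sum below 1
    excludes both large neighbourhoods and good families. *)
Lemma top_grad_le_of_moments (B : bip n m) : (0 < d)%N ->
  big_nbhds B + all_fams B < 1 ->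
  top_grad_le (rig_adj B) k (INR (k.+1 * (d * d) * (C * k.+1))%N).
Proof.
move=> d0 lt1 h eH h0 minor; set f := INR (_ * _)%N.
case: (Rle_lt_dec (INR (nedges eH) / INR h) f) => [//|dense]; exfalso.
have H0 : 0 < INR h by apply: lt_0_INR; apply/ltP.
have := Rmult_lt_compat_r _ _ _ H0 dense.
have -> : INR (nedges eH) / INR h * INR h = INR (nedges eH) by field; lra.
rewrite /f -mult_INR => /INR_lt/ltP/ltnW.
rewrite multE -!mulnA [(k.+1 * h)%N]mulnC !mulnA => dn.
have big_lt := big_nbhds_ge0 B; have fam0 := all_fams_ge0 B.
have nb a : (#|nbhd B a| <= d)%N.
  by rewrite leqNgt; apply/negP => /big_nbhds_ge1; lra.
have [||S [Sh [l [t [gt pt]]]]] := @dense_minor_family n m B d k C h eH nb minor.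
- by [].
- by rewrite !mulnA.
have hn : (0 < h <= n)%N.
  by rewrite h0 -Sh (leq_trans (max_card _)) ?card_ord.
by have := all_fams_ge1 hn Sh gt pt; lra.
Qed.

Hypothesis p01 : 0 <= p <= 1.

Lemma Ex_big_nbhds : Ex p big_nbhds <= INR m * (INR n * p) ^ d.+1.
Proof.
rewrite /big_nbhds Ex_sum.
apply: (Rle_trans _ (\big[Rplus/0]_(a < m) ((INR n * p) ^ d.+1))); last first.
  by rewrite Rsum_const card_ord; right.
apply: Rsum_le => a _; rewrite Ex_sum.
rewrite (eq_bigr (fun=> p ^ d.+1)); last first.
  by move=> S /eqP Sd; rewrite Ex_subset cardsX cards1 muln1 Sd.
rewrite Rsum_const Rpow_mult_distr; apply: Rmult_le_compat_r; first by apply: pow_le; lra.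
have -> : #|[pred S : {set 'I_n} | #|S| == d.+1]| = 'C(n, d.+1).
  by rewrite -[n in 'C(n, _)]card_ord -card_draws; apply: eq_card => S; rewrite !inE.
apply: Rle_trans (bin_le_pow n d.+1).
rewrite -[X in X <= _]Rmult_1_r; apply: Rmult_le_compat_l; first exact: pos_INR.
by apply: (le_INR 1); apply/leP/fact_gt0.
Qed.

Lemma Ex_all_fams x K : (0 < n)%N -> INR m * INR n * p ^ 2 <= x ->
  0 <= x -> (forall l, (l < k.+1)%N -> x ^ l.+1 <= K) ->
  (2 <= C)%N -> 36 * K <= INR C ->
  Ex p all_fams <= INR k.+1 * (2 / INR n).
Proof.
move=> n0 mnp x0 xK C2 KC.
have K0 : 0 <= K by apply: Rle_trans (xK 0%N isT); apply: pow_le.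
have N0 : 0 < INR n by apply: lt_0_INR; apply/ltP.
have iN0 : 0 < / INR n by apply: Rinv_0_lt_compat.
have fam_le (h : nat) (l : 'I_k.+1) (S : {set 'I_n}) : #|S| = h ->
    Ex p (fams h l S) <= / INR (C * h)`! * (INR h * INR h / INR n * K) ^ (C * h).
  move=> Sh; rewrite /fams ExZ Ex_sum; apply: Rmult_le_compat_l.
    by left; apply/Rinv_0_lt_compat/lt_0_INR/ltP/fact_gt0.
  rewrite (eq_bigr (fun=> p ^ (C * h * (l.+1 * 2)))); last first.
    by move=> t gt; rewrite (Ex_present p gt).
  rewrite Rsum_const.
  have cg := le_INR _ _ (elimT leP (card_good_fam m l (C * h) S)).
  rewrite Sh INR_expn in cg.
  have pp : 0 <= p ^ (C * h * (l.+1 * 2)) by apply: pow_le; lra.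
  apply: (Rle_trans _ _ _ (Rmult_le_compat_r _ _ _ pp cg)).
  have -> : p ^ (C * h * (l.+1 * 2)) = ((p ^ 2) ^ l.+1) ^ (C * h).
    rewrite -!pow_mult; congr (_ ^ _); rewrite !multE [RHS]mulnC mulnA; congr (_ * _)%N.
    exact: mulnC.
  rewrite -Rpow_mult_distr.
  apply: pow_incr; split.
    by apply: Rmult_le_pos; [exact: pos_INR|do 2!apply: pow_le; lra].
  rewrite -!multE !mult_INR multE INR_expn -multE mult_INR.
  (* Number of walks times presence probability of one walk: fixing both ends in [S] replaces n^2 by
     h^2 and leaves h^2 / n times a power of m n p^2. *)
  have -> : INR h * ((INR m * INR n) ^ l * (INR m * INR h)) * (p ^ 2) ^ l.+1 =
     INR h * INR h / INR n * (INR m * INR n * p ^ 2) ^ l.+1.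
    by rewrite !Rpow_mult_distr -![_ ^ l.+1]/(_ * _ ^ l); field; lra.
  apply: Rmult_le_compat_l.
    by apply: Rmult_le_pos; [have := pos_INR h; nra|lra].
  apply: Rle_trans (xK l (ltn_ord l)); apply: pow_incr; split => //.
  apply: Rmult_le_pos; last by apply: pow_le; lra.
  by apply: Rmult_le_pos; apply: pos_INR.
rewrite /all_fams Ex_sum.
apply: (Rle_trans _ (\big[Rplus/0]_(h < n.+1 | (0 < h)%N) (INR k.+1 * / INR n * (/ 2) ^ h))).
  apply: Rsum_le => h h0; rewrite Ex_sum.
  apply: (Rle_trans _ (\big[Rplus/0]_(l < k.+1) (/ INR n * (/ 2) ^ h))); last first.
    by rewrite Rsum_const card_ord; lra.
  apply: Rsum_le => l _; rewrite Ex_sum.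
  apply: (Rle_trans _ (\big[Rplus/0]_(S : {set 'I_n} | #|S| == h)
     (/ INR (C * h)`! * (INR h * INR h / INR n * K) ^ (C * h)))).
    by apply: Rsum_le => S /eqP Sh; apply: fam_le.
  rewrite Rsum_const.
  have -> : #|[pred S : {set 'I_n} | #|S| == h]| = 'C(n, h).
    by rewrite -[n in 'C(n, _)]card_ord -card_draws; apply: eq_card => S; rewrite !inE.
  by apply: family_term_bound => //; rewrite h0 -ltnS ltn_ord.
apply: (Rle_trans _ (\big[Rplus/0]_(h < n.+1) (INR k.+1 * / INR n * (/ 2) ^ h))).
  rewrite big_mkcond; apply: Rsum_le => h _; case: ifP => _; first by lra.
  apply: Rmult_le_pos; last by apply: pow_le; lra.
  by apply: Rmult_le_pos; [exact: pos_INR|lra].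
set K1 := INR k.+1; rewrite -big_distrr /= /Rdiv Rmult_assoc; apply: Rmult_le_compat_l; first exact: pos_INR.
rewrite Rmult_comm; apply: Rmult_le_compat_r; first by lra.
exact: sum_half.
Qed.

End FirstMoment.

Lemma case_gt1 (alpha beta gamma : R) : 1 < alpha -> 0 < beta -> 0 < gamma ->
  bounded_expansion alpha beta gamma /\
  exists C : R, whp alpha beta gamma (fun n (e : rel 'I_n) => INR (degeneracy e) <= C).
Proof.
move=> alpha1 beta0 gamma0; have alpha0 : 0 < alpha by lra.
(* Chosen so that m (np)^(d + 1), of order n^(alpha + (1 - alpha)(d + 1) / 2), is O(1 / n). *)
have [d dbig] := INR_unbounded (2 * (alpha + 1) / (alpha - 1)).
have d0 : (0 < d)%N.
  apply/ltP/INR_lt; apply: Rlt_trans dbig; apply: Rdiv_lt_0_compat; rewrite /=; lra.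
have {}dbig : alpha + (1 - alpha) / 2 * INR d.+1 <= - 1.
  have : 2 * (alpha + 1) / (alpha - 1) * (alpha - 1) <= INR d * (alpha - 1).
    by apply: Rmult_le_compat_r; lra.
  have -> : 2 * (alpha + 1) / (alpha - 1) * (alpha - 1) = 2 * (alpha + 1) by field; lra.
  by rewrite S_INR; lra.
(* Bounds m n p^2; being at least 1, its powers up to k + 1 are all at most x^(k + 1). *)
pose x := Rmax 1 (beta * gamma ^ 2).
have x1 : 1 <= x by apply: Rmax_l.
have exC k : exists C : nat, (2 <= C)%N /\ 36 * x ^ k.+1 <= INR C.
  have [C hC] := INR_unbounded (36 * x ^ k.+1 + 2); exists C; split; last by lra.
  have : 0 <= x ^ k.+1 by apply: pow_le; lra.
  by move=> ?; apply/leP/INR_le; rewrite /=; lra.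
pose Cof k := proj1_sig (constructive_indefinite_description _ (exC k)).
have CP k : (2 <= Cof k)%N /\ 36 * x ^ k.+1 <= INR (Cof k).
  by rewrite /Cof; case: constructive_indefinite_description.
pose f k := INR (k.+1 * (d * d) * (Cof k * k.+1))%N.
(* Stated for every consequence [E] of the grad bound, so that it serves both the bounded expansion
   and, with k = 0, the degeneracy. *)
have main k (E : forall n : nat, rel 'I_n -> Prop) :
    (forall n m (B : bip n m), top_grad_le (rig_adj B) k (f k) -> E n (rig_adj B)) ->
    whp alpha beta gamma E.
  move=> fE; apply: whp_intro => // eps eps0.
  have [C2 KC] := CP k.
  have := ev_and (ev_p01 alpha0 gamma0) (ev_and (ev_INR 1)
    (ev_INR ((beta * gamma ^ d.+1 + INR k.+1 * 2) / eps))).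
  apply: ev_imp => n [p01 [n1 nbig]].
  have n0 : (0 < n)%N by apply/ltP/INR_lt; rewrite /=; lra.
  have N0 : 0 < INR n by lra.
  set p := p_of _ _ _ in p01 *; set m := m_of _ _ _.
  have [_ mle] := m_of_bounds alpha beta0 n; rewrite -/m in mle.
  have npE : INR n * p = gamma * Rpower (INR n) ((1 - alpha) / 2) by apply: INR_p_of.
  have e1 : Ex p (@big_nbhds n m d) <= beta * gamma ^ d.+1 * / INR n.
    apply: (Rle_trans _ _ _ (Ex_big_nbhds _ _ _ p01)); rewrite npE Rpow_mult_distr.
    rewrite -[Rpower _ _ ^ _]Rpower_pow; last exact: Rpower_gt0.
    rewrite Rpower_mult.
    apply: (Rle_trans _ (beta * Rpower (INR n) alpha *
        (gamma ^ d.+1 * Rpower (INR n) ((1 - alpha) / 2 * INR d.+1)))).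
      apply: Rmult_le_compat_r => //; apply: Rmult_le_pos; first by apply: pow_le; lra.
      exact/Rlt_le/Rpower_gt0.
    have -> : beta * Rpower (INR n) alpha *
        (gamma ^ d.+1 * Rpower (INR n) ((1 - alpha) / 2 * INR d.+1)) =
        beta * gamma ^ d.+1 * Rpower (INR n) (alpha + (1 - alpha) / 2 * INR d.+1).
      by rewrite Rpower_plus; ring.
    apply: Rmult_le_compat_l; first by apply: Rmult_le_pos; [lra|apply: pow_le; lra].
    apply: (Rle_trans _ (Rpower (INR n) (- 1))); first by apply: Rle_Rpower.
    by rewrite Rpower_Ropp Rpower_1 //; right.
  have mnp : INR m * INR n * p ^ 2 <= x.
    apply: (Rle_trans _ (beta * gamma ^ 2)); last exact: Rmax_r.
    have -> : INR m * INR n * p ^ 2 = INR m * (INR n * p) ^ 2 / INR n by field; lra.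
    rewrite npE Rpow_mult_distr -[Rpower _ _ ^ _]Rpower_pow; last exact: Rpower_gt0.
    rewrite Rpower_mult (_ : (1 - alpha) / 2 * INR 2 = 1 + - alpha); last by rewrite /=; field.
    rewrite Rpower_plus Rpower_1 // Rpower_Ropp.
    have A0 := Rpower_gt0 (INR n) alpha.
    have -> : INR m * (gamma ^ 2 * (INR n * / Rpower (INR n) alpha)) / INR n =
       INR m * (gamma ^ 2 / Rpower (INR n) alpha) by field; lra.
    have -> : beta * gamma ^ 2 = beta * Rpower (INR n) alpha * (gamma ^ 2 / Rpower (INR n) alpha).
      by field; lra.
    apply: Rmult_le_compat_r => //; apply: Rmult_le_pos; first by apply: pow_le; lra.
    by left; apply: Rinv_0_lt_compat.
  have e2 : Ex p (@all_fams n m k (Cof k)) <= INR k.+1 * (2 / INR n).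
    apply: (Ex_all_fams p01 n0 mnp _ _ C2 KC); first by lra.
    by move=> l lk; apply: Rle_pow => //; apply/leP.
  apply: (Rle_trans _ (1 - Ex p (fun B => @big_nbhds n m d B + @all_fams n m k (Cof k) B))).
    rewrite ExD.
    have : (beta * gamma ^ d.+1 + INR k.+1 * 2) / INR n <= eps.
      apply: (Rmult_le_reg_r (INR n)) => //.
      have -> : (beta * gamma ^ d.+1 + INR k.+1 * 2) / INR n * INR n =
        (beta * gamma ^ d.+1 + INR k.+1 * 2) / eps * eps by field; lra.
      by rewrite [eps * _]Rmult_comm; apply: Rmult_le_compat_r; lra.
    by lra.
  apply: prob_G_ge => // B; first by have := big_nbhds_ge0 d B; have := all_fams_ge0 k (Cof k) B; lra.
  move=> nE; case: (Rle_lt_dec 1 (big_nbhds d B + all_fams k (Cof k) B)) => // lt1.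
  by case: nE; apply: fE; apply: top_grad_le_of_moments.
split; first by exists f => k; apply: (main k).
exists (2 * f 0%N); apply: (main 0%N) => n m B grad.
apply: degeneracy_le_top_grad => //; [exact: rig_adj_sym|exact: rig_adj_irr|exact: pos_INR].
Qed.

Theorem mainTheorem1 (alpha beta gamma : R) :
  (0 < alpha) -> (0 < beta) -> (0 < gamma) ->
  ((alpha < 1) ->
     somewhere_dense alpha beta gamma /\
     exists c : R, (0 < c) /\
       whp alpha beta gamma (fun n (e : rel 'I_n) =>
         (c * gamma * Rpower (INR n) ((1 - alpha) / 2) <= INR (degeneracy e))))
  /\
  (alpha = 1 ->
     somewhere_dense alpha beta gamma /\
     exists c : R, (0 < c) /\
       whp alpha beta gamma (fun n (e : rel 'I_n) =>
         (c * (ln (INR n) / ln (ln (INR n))) <= INR (degeneracy e))))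
  /\
  ((1 < alpha) ->
     bounded_expansion alpha beta gamma /\
     exists C : R,
       whp alpha beta gamma (fun n (e : rel 'I_n) => (INR (degeneracy e) <= C))).
Proof.
move=> alpha0 beta0 gamma0; split; first exact: case_lt1.
by split=> [->|alpha1]; [exact: case_eq1|exact: case_gt1].
Qed.
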